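(* There is a contractible but non-collapsible $3$-dimensional simplicial complex with face vector $f=(106,596,1064,573)$ that has two distinct optimal discrete Morse vectors, namely $(1,1,1,0)$ and $(1,0,1,1)$.
   Context: A simplicial complex is collapsible if it can be reduced to a single vertex by elementary collapses (each removing a face $\sigma$ properly contained in exactly one other face $\tau$, together with $\tau$). A discrete Morse function on a simplicial complex is meant in the sense of Forman; its discrete Morse vector is $(c_0,\dots,c_d)$ where $c_i$ is the number of critical $i$-dimensional faces. A discrete Morse vector of a complex is optimal if it minimizes the total number $c_0+\dots+c_d$ of critical faces among all discrete Morse functions on the complex. The face vector $f=(f_0,f_1,f_2,f_3)$ lists the numbers of faces of each dimension. *)

(* Defs.v *)
From HB Require Import structures.
From mathcomp Require Import all_boot all_order all_algebra.
From mathcomp Require Import all_classical reals topology normedtype.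

Set Implicit Arguments.
Unset Strict Implicit.
Unset Printing Implicit Defensive.

Import Order.TTheory GRing.Theory Num.Theory.
Import numFieldNormedType.Exports.

Local Open Scope ring_scope.

(* The empty set is never a face; an element v of V is a vertex of K exactly
   when [set v] \in K. *)
Definition simplicial_complex (V : finType) (K : {set {set V}}) : Prop :=
  finset.set0 \notin K /\
  (forall s t : {set V}, s \in K -> t \subset s -> t != finset.set0 -> t \in K).

(* A face with n vertices has dimension n.-1. *)
Definition dimension (V : finType) (K : {set {set V}}) : nat :=
  (\max_(s in K) #|s|.-1)%N.

Definition face_vector (V : finType) (K : {set {set V}}) : seq nat :=
  mkseq (fun i => #|[set s in K | #|s| == i.+1]|%SET) (dimension K).+1.

(* Geometric realization in barycentric coordinates.  As V is finite, the
   subspace topology induced by the product topology on V -> R is the usual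
   topology of the polyhedron. *)
Definition realization (R : realType) (V : finType) (K : {set {set V}}) :
    set {ptws V -> R} :=
  [set x | [/\ forall v, 0 <= x v,
               \sum_v x v = 1 &
               [set v | x v != 0]%SET \in K]]%classic.

Arguments realization R {V} K.

(* The identity of the subspace A is homotopic, inside A, to a constant map. *)
Definition contractible (R : realType) (X : topologicalType) (A : set X) :
    Prop :=
  exists (a : X) (H : X * R -> X),
    [/\ A a,
        {within A `*` `[0, 1], continuous H}%classic,
        forall x t, A x -> 0 <= t <= 1 -> A (H (x, t)),
        forall x, A x -> H (x, 0) = x &
        forall x, A x -> H (x, 1) = a].

Definition elementary_collapse (V : finType) : rel {set {set V}} :=
  fun K L => [exists s in K, exists t in K,
    ([set u in K | s \proper u]%SET == [set t]%SET) &&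
    (L == K :\: [set s; t]%SET)].

Definition collapsible (V : finType) (K : {set {set V}}) : bool :=
  [exists v : V, connect (@elementary_collapse V) K [set [set v]]%SET].

Section DiscreteMorse.
Variables (R : realType) (V : finType) (K : {set {set V}}).
Implicit Types (f : {set V} -> R) (s : {set V}) (c : seq nat).

Definition upper_exceptions f s : {set {set V}} :=
  [set t in K | [&& s \subset t, #|t| == #|s|.+1 & f t <= f s]]%SET.

Definition lower_exceptions f s : {set {set V}} :=
  [set u in K | [&& u \subset s, #|s| == #|u|.+1 & f s <= f u]]%SET.

(* Only the values of f on faces of K matter. *)
Definition discrete_morse_function f : Prop :=
  forall s, s \in K ->
    (#|upper_exceptions f s| <= 1)%N /\ (#|lower_exceptions f s| <= 1)%N.

Definition critical f s : bool :=
  [&& s \in K, upper_exceptions f s == finset.set0 & lower_exceptions f s == finset.set0].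

Definition morse_vector f : seq nat :=
  mkseq (fun i => #|[set s | critical f s & #|s| == i.+1]|%SET)
        (dimension K).+1.

Definition is_discrete_morse_vector c : Prop :=
  exists2 f, discrete_morse_function f & morse_vector f = c.

Definition optimal_discrete_morse_vector c : Prop :=
  is_discrete_morse_vector c /\
  (forall c', is_discrete_morse_vector c' -> (sumn c <= sumn c')%N).

End DiscreteMorse.

Arguments optimal_discrete_morse_vector R {V} K c.

(* Main.v *)
(* The complex is K = N u o*D u Y u F.  Here D is the 8-vertex dunce hat, N a
   complex containing D, with four tetrahedra, which collapses both to D and to
   a point, o*D the cone over D, and Y a 2-complex, none of whose triangles lies
   in a tetrahedron, which contains all edges of D and collapses onto them from
   its only free edge a, which joins o to a vertex p of D.  F is a collapsible
   filler which only adjusts the face vector.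

   Y protects the edges of D, so in a collapse of K the link of o in o*D loses
   faces only by collapses and by the removal of triangles.  As D has no free
   face, the first change is the removal of a triangle; from then on the link is
   connected with Euler characteristic at most 0.  Hence it never shrinks to the
   point p, a never becomes free, and K is not collapsible.

   Up to collapses, removing a tetrahedron and then a triangle of o*D frees a, so
   that Y collapses away, and the remaining N is collapsible: this gives
   (1,0,1,1).  Collapsing N to D instead makes the triangles of D free; after
   collapsing o*D through one of them, removing one triangle at o frees a, and
   what remains is D without a triangle, which collapses to a circle: this gives
   (1,1,1,0).

   A discrete Morse function with a single critical face would make K
   collapsible, and the number of critical faces is odd since K has an odd
   number of faces; so three critical faces are optimal.  Finally K is
   contractible, because the union of K and the cone o*N collapses both to K
   and to a point. *)

Require Import Defs.
From mathcomp Require Import all_boot all_order all_algebra.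
From mathcomp Require Import all_classical reals topology normedtype.
From mathcomp Require Import lra zify.
From Stdlib Require FMapPositive.

Set Implicit Arguments.
Unset Strict Implicit.
Unset Printing Implicit Defensive.

Import Order.TTheory GRing.Theory Num.Theory.
Import numFieldNormedType.Exports.

(** * Collapses and discrete Morse functions *)

Section Collapse.
Local Open Scope set_scope.
Local Notation set0 := finset.set0.
Variable V : finType.
Implicit Types (K L : {set {set V}}) (s t u : {set V}).

(** Adding to [s] a single vertex of [t] already gives a proper coface of [s] in [L], which by
    uniqueness is [t]. *)
Lemma free_face_card L s t : simplicial_complex L ->
  [set u in L | s \proper u] = [set t] -> #|t| = #|s|.+1.
Proof.
move=> [_ cl] free.
have : t \in [set u in L | s \proper u] by rewrite free inE.
rewrite inE => /andP[tL st]; have [ss [w wt ws]] := fintype.properP st.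
have -> : t = w |: s; last by rewrite cardsU1 ws.
apply/esym/eqP; rewrite -finset.in_set1 -free inE; apply/andP; split; last first.
  by apply/fintype.properP; split; [exact: finset.subsetUr|exists w; rewrite ?inE ?eqxx].
apply: cl tL _ _; first by rewrite finset.subUset finset.sub1set wt ss.
by rewrite -card_gt0 cardsU1 ws.
Qed.

(** A surviving face that contained [s] or [t] would be a proper coface of [s], hence equal to
    [t]. *)
Lemma collapse_complex L s t : simplicial_complex L ->
  [set u in L | s \proper u] = [set t] -> simplicial_complex (L :\: [set s; t]).
Proof.
move=> [L0 cl] free; split=> [|a b]; first by rewrite inE (negPf L0) andbF.
have cof c : c \in L -> s \proper c -> c = t.
  by move=> cK sc; apply/eqP; rewrite -finset.in_set1 -free inE cK.
have st : s \proper t.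
  have : t \in [set u in L | s \proper u] by rewrite free inE.
  by rewrite inE => /andP[].
rewrite !inE !negb_or -!andbA => /and3P[as_ at_ aL] ba bN; rewrite (cl _ _ aL ba bN) andbT.
apply/andP; split; apply: contraNneq at_ => e; apply/eqP; apply: cof => //.
  by rewrite finset.properEneq eq_sym as_ -e.
by apply: (fintype.proper_sub_trans st); rewrite -e.
Qed.

End Collapse.

(** * Forman's theory: exclusive exceptions, parity, and collapsing along a Morse function *)

Section Forman.
Local Open Scope set_scope.
Local Notation set0 := finset.set0.
Variables (R : realType) (V : finType) (f : {set V} -> R).
Implicit Types (K L : {set {set V}}) (s t u : {set V}).

Lemma upper_exception_inj K s t t' : discrete_morse_function K f -> s \in K ->
  t \in upper_exceptions K f s -> t' \in upper_exceptions K f s -> t = t'.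
Proof. by move=> fM sK tu tu'; have [/card_le1_eqP h _] := fM s sK; exact: h. Qed.

Lemma lower_exception_inj K s u u' : discrete_morse_function K f -> s \in K ->
  u \in lower_exceptions K f s -> u' \in lower_exceptions K f s -> u = u'.
Proof. by move=> fM sK ul ul'; have [_ /card_le1_eqP h] := fM s sK; exact: h. Qed.

(** Forman's diamond argument: adding to [u] the vertex of [t] outside [s] gives a second face [s']
    between [u] and [t]. As exceptions are unique, [f u < f s' < f t <= f s <= f u]. *)
Lemma morse_exclusive K s t u :
  simplicial_complex K -> discrete_morse_function K f ->
  t \in upper_exceptions K f s -> u \in lower_exceptions K f s -> False.
Proof.
move=> [K0 cl] fM; rewrite !inE => /and4P[tK st /eqP ct fts] /and4P[uK us /eqP cu fsu].
have uN : u != set0 by apply: contraNneq K0 => <-.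
have sK : s \in K by apply: cl tK st _; rewrite -card_gt0 cu.
have [w wt ws] : exists2 w, w \in t & w \notin s.
  apply/fintype.subsetPn; apply/negP => /subset_leq_card.
  by rewrite ct ltnn.
have wu : w \notin u by apply: contra ws; exact: fintype.subsetP us w.
pose s' := w |: u; have cs' : #|s'| = #|s| by rewrite cardsU1 wu cu.
have s't : s' \subset t.
  by rewrite finset.subUset finset.sub1set wt (fintype.subset_trans us st).
have s'K : s' \in K by apply: cl tK s't _; rewrite -card_gt0 cs' cu.
have s's : s' != s by apply: contraNneq ws => <-; rewrite !inE eqxx.
have f1 : (f s' < f t)%R.
  rewrite ltNge; apply: contraNN s's => le.
  apply/eqP; apply: (lower_exception_inj fM tK).
    by rewrite inE s'K s't ct cs' eqxx le.
  by rewrite inE sK st ct eqxx.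
have f2 : (f u < f s')%R.
  rewrite ltNge; apply: contraNN s's => le.
  apply/eqP; apply: (upper_exception_inj fM uK).
    by rewrite inE s'K finset.subsetUr cs' cu eqxx le.
  by rewrite inE sK us cu eqxx.
by have := lt_trans f2 (lt_le_trans f1 (le_trans fts fsu)); rewrite ltxx.
Qed.

Let rel s t := [&& s \subset t, #|t| == #|s|.+1 & (f t <= f s)%R].

Lemma card_upper K s : s \in K -> #|upper_exceptions K f s| = \sum_(t in K) rel s t.
Proof.
move=> sK; rewrite -sum1dep_card big_mkcondr; apply: eq_bigr => t _.
by rewrite -/(rel s t); case: rel.
Qed.

Lemma card_lower K t : t \in K -> #|lower_exceptions K f t| = \sum_(s in K) rel s t.
Proof.
move=> tK; rewrite -sum1dep_card big_mkcondr; apply: eq_bigr => s _.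
by rewrite -/(rel s t); case: rel.
Qed.

(** By [morse_exclusive] each noncritical face has exactly one exception, upper or lower. Upper and
    lower exceptions count the same pairs, so the number of noncritical faces is even. *)
Lemma morse_parity K : simplicial_complex K -> discrete_morse_function K f ->
  odd #|K| = odd #|[set s | critical K f s]|.
Proof.
move=> sc fM.
have split1 s : s \in K ->
    1 = critical K f s + (#|upper_exceptions K f s| + #|lower_exceptions K f s|).
  move=> sK; have [u1 l1] := fM s sK; rewrite /critical sK /=.
  rewrite -!cards_eq0.
  have : ~~ ((0 < #|upper_exceptions K f s|) && (0 < #|lower_exceptions K f s|)).
    by apply/andP => -[/card_gt0P[t tu] /card_gt0P[u ul]]; exact: morse_exclusive tu ul.
  by case: #|_| u1 => [|[|]] //; case: #|_| l1 => [|[|]].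
rewrite -[#|K|]sum1_card (eq_bigr _ split1) !big_split /=.
rewrite (eq_bigr _ (@card_upper K)) (eq_bigr _ (@card_lower K)).
rewrite [X in _ + (_ + X)]exchange_big /= addnn oddD odd_double addbF.
congr odd; rewrite -sum1dep_card [RHS]big_mkcond /= [LHS]big_mkcond /=.
by apply: eq_bigr => s _; rewrite /critical; case: (s \in K) => //=; case: (_ && _).
Qed.

Lemma sumn_morse_vector K : simplicial_complex K ->
  sumn (morse_vector K f) = #|[set s | critical K f s]|.
Proof.
move=> [K0 _]; rewrite sumnE /morse_vector big_map.
rewrite (_ : iota 0 _ = index_iota 0 (dimension K).+1); last by rewrite /index_iota subn0.
rewrite big_mkord.
rewrite -[RHS]sum1dep_card.
transitivity (\sum_(i < (dimension K).+1) \sum_(s | critical K f s) (#|s| == i.+1)).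
  apply: eq_bigr => i _; rewrite -sum1dep_card big_mkcondr; apply: eq_bigr => s _.
  by case: eqP.
rewrite exchange_big /=; apply: eq_bigr => s /and3P[sK _ _].
(* No face is empty, so the predecessor in [dimension] is exact. *)
have s0 : 0 < #|s| by rewrite card_gt0; apply: contraNneq K0 => <-.
have sd : #|s|.-1 < (dimension K).+1.
  by rewrite ltnS; exact: (leq_bigmax_cond (F := fun s : {set V} => #|s|.-1)).
rewrite (bigD1 (Ordinal sd)) //= prednK // eqxx big1 // => i /eqP ni.
by apply/eqP; rewrite eqb0; apply/eqP => e; apply: ni; apply/val_inj; rewrite /= e.
Qed.

(* A vertex with the smallest value among vertices is critical. *)
Lemma critical_vertex K : simplicial_complex K -> discrete_morse_function K f ->
  K != set0 -> exists v, critical K f [set v].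
Proof.
move=> [K0 cl] fM /set0Pn[s sK].
have [v0 v0K] : exists v0, [set v0] \in K.
  have /set0Pn[v vs] : s != set0 by apply: contraNneq K0 => <-.
  by exists v; apply: cl sK _ _; rewrite ?finset.sub1set // -cards_eq0 cards1.
have [v vK vmin] : exists2 v, [set v] \in K & forall w, [set w] \in K -> (f [set v] <= f [set w])%R.
  by case: (@arg_minP _ R V v0 (fun v => [set v] \in K) (fun v => f [set v]) v0K) => v vK vm; exists v.
exists v; apply/and3P; split=> //; rewrite -finset.subset0; apply/fintype.subsetP => t.
  rewrite inE cards1 => /and4P[tK vt /cards2P[x [y [xy tE]]] le]; exfalso.
  have [w wt wv] : exists2 w, w \in t & w != v.
    move: vt; rewrite finset.sub1set tE !inE => /orP[]/eqP->.
      by exists y; rewrite ?inE ?eqxx ?orbT // eq_sym.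
    by exists x; rewrite ?inE ?eqxx.
  have wK : [set w] \in K by apply: cl tK _ _; rewrite ?finset.sub1set // -cards_eq0 cards1.
  have := @lower_exception_inj K t [set v] [set w] fM tK.
  rewrite !inE vK wK vt finset.sub1set wt !cards1 tE cards2 xy /= -tE le.
  move=> /(_ isT (le_trans le (vmin w wK))) /finset.set1_inj e.
  by rewrite e eqxx in wv.
rewrite inE cards1 => /and4P[tK _ /eqP[/esym/eqP]].
by rewrite cards_eq0 => /eqP e; rewrite e (negPf K0) in tK.
Qed.

(** Induction on the number of faces. If no face has an upper exception, all faces are critical and
    [K] is a vertex. Otherwise a face [s] of largest value among those with an upper exception is
    free, and collapsing it leaves the critical faces unchanged. *)
Lemma morse_collapsible K : simplicial_complex K -> discrete_morse_function K f ->
  #|[set s | critical K f s]| = 1%N -> collapsible K.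
Proof.
have [n] := ubnP #|K|; elim: n K => // n IH K /ltnSE-leKn sc fM c1.
have KN : K != set0.
  apply/eqP => K0; move: c1; rewrite K0 (_ : [set _ | _] = set0) ?cards0 //.
  by apply/setP => s; rewrite !inE /critical inE.
have [v0 cv0] := critical_vertex sc fM KN.
have only s : critical K f s -> s = [set v0].
  move=> cs; move/eqP: c1 => /cards1P[x e].
  have : s \in [set x] by rewrite -e inE.
  have : [set v0] \in [set x] by rewrite -e inE.
  by rewrite !inE => /eqP-> /eqP.
pose low s := (s \in K) && (upper_exceptions K f s != set0).
have [s0 ls0|nolow] := pickP low; last first.
  have allc s : s \in K -> critical K f s.
    move=> sK; apply/and3P; split=> //.
      by move: (nolow s); rewrite /low sK /= => /negbFE.
    rewrite -finset.subset0; apply/fintype.subsetP => u ul; exfalso.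
    move: (ul); rewrite inE => /and4P[uK us cs le].
    move: (nolow u); rewrite /low uK /= => /negbFE /eqP e.
    by have := finset.in_set0 s; rewrite -e inE sK us cs le.
  apply/existsP; exists v0; rewrite (_ : K = [set [set v0]]) ?connect0 //.
  apply/setP => s; rewrite inE; apply/idP/eqP => [/allc/only//|->].
  by case/and3P: cv0.
have [s ls smax] : exists2 s, low s & forall u, low u -> (f u <= f s)%R.
  by case: (@arg_maxP _ R _ s0 low f ls0) => s ls m; exists s.
have /andP[sK /set0Pn[t tu]] := ls.
have [K0 cl] := sc.
move: (tu); rewrite inE => /and4P[tK st /eqP ct fts].
have sl : s \in lower_exceptions K f t by rewrite inE sK st ct eqxx.
have sN : s != set0 by apply: contraNneq K0 => <-.
(* A second coface of [s] would itself be paired, with a larger lower face. *)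
have free1 u : u \in K -> s \subset u -> #|u| = #|s|.+1 -> u = t.
  move=> uK su cu; apply/eqP; apply: contraT => ut.
  have fsu : (f s < f u)%R.
    rewrite ltNge; apply: contraNN ut => le; apply/eqP.
    by apply: (upper_exception_inj fM sK _ tu); rewrite inE uK su cu eqxx.
  have [lu|] := boolP (low u).
    by have := lt_le_trans fsu (smax u lu); rewrite ltxx.
  rewrite /low uK /= negbK => upu.
  have [lou|/set0Pn[s']] := eqVneq (lower_exceptions K f u) set0.
    have : critical K f u by rewrite /critical uK upu lou eqxx.
    move/only => e; move: cu; rewrite e cards1 => -[] /esym/eqP.
    by rewrite cards_eq0 (negPf sN).
  rewrite inE => /and4P[s'K s'u cs' le].
  have ls' : low s' by rewrite /low s'K; apply/set0Pn; exists u; rewrite inE uK s'u cs'.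
  by have := lt_le_trans fsu (le_trans le (smax s' ls')); rewrite ltxx.
(* A coface with more vertices would contain two different faces obtained from [s] by adding one
   vertex, against [free1]. *)
have free : [set u in K | s \proper u] = [set t].
  apply/setP => u; rewrite !inE; apply/andP/eqP => [[uK su]|->]; last first.
    by rewrite tK finset.properEcard st ct ltnSn.
  have [w wu ws] : exists2 w, w \in u & w \notin s by case/fintype.properP: su.
  have sw : #|w |: s| = #|s|.+1 by rewrite cardsU1 ws.
  have swu : w |: s \subset u by rewrite finset.subUset finset.sub1set wu; case/andP: su.
  have wsK : w |: s \in K by apply: cl uK swu _; rewrite -card_gt0 sw.
  have tE : w |: s = t by apply: free1; rewrite // finset.subsetUr.
  have [//|ut] := eqVneq u t.
  have [w' w'u w't] : exists2 w', w' \in u & w' \notin t.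
    apply/fintype.subsetPn; apply: contra ut => uts; rewrite finset.eqEsubset uts.
    by rewrite -tE.
  have w's : w' \notin s by apply: contra w't; exact: fintype.subsetP st w'.
  have sw' : #|w' |: s| = #|s|.+1 by rewrite cardsU1 w's.
  have sw'u : w' |: s \subset u by rewrite finset.subUset finset.sub1set w'u; case/andP: su.
  have ws'K : w' |: s \in K by apply: cl uK sw'u _; rewrite -card_gt0 sw'.
  have e : w' |: s = t by apply: free1; rewrite // finset.subsetUr.
  by move: w't; rewrite -e !inE eqxx.
have s_nt : s != t by apply/eqP => e; move: ct; rewrite e => /eqP; rewrite -addn1 -[X in X == _]addn0 eqn_add2l.
pose L := K :\: [set s; t].
have LK : L \subset K by exact: finset.subsetDl.
have memL u : (u \in L) = [&& u != s, u != t & u \in K].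
  by rewrite !inE negb_or andbA.
have upL u : upper_exceptions L f u = upper_exceptions K f u :\: [set s; t].
  by apply/setP => x; rewrite !inE; case: (x \in K); rewrite /= ?andbF ?andbT.
have loL u : lower_exceptions L f u = lower_exceptions K f u :\: [set s; t].
  by apply/setP => x; rewrite !inE; case: (x \in K); rewrite /= ?andbF ?andbT.
have scL : simplicial_complex L := collapse_complex sc free.
have fL : discrete_morse_function L f.
  move=> u; rewrite memL => /and3P[_ _ /fM[u1 l1]].
  by rewrite upL loL; split; [apply: leq_trans u1|apply: leq_trans l1];
     apply/subset_leq_card/finset.subsetDl.
(* A remaining face with [s] or [t] as an exception would violate [morse_exclusive] or the
   uniqueness of exceptions, so no remaining face becomes critical. *)
have cL : [set u | critical L f u] = [set u | critical K f u].
  apply/setP => u; rewrite !inE /critical memL upL loL.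
  apply/idP/idP; last first.
    case/and3P=> uK /eqP up /eqP lo; rewrite uK up lo !finset.set0D eqxx !andbT.
    apply/andP; split; apply/eqP => e.
      by have := finset.in_set0 t; rewrite -up e tu.
    by have := finset.in_set0 s; rewrite -lo e sl.
  case/and3P=> /and3P[us ut uK] up lo; rewrite uK /=.
  apply/andP; split; apply: contraT => /set0Pn[x xe]; exfalso.
    move: (xe); rewrite inE => /and4P[xK ux cx le].
    have ux' : u \in lower_exceptions K f x by rewrite inE uK ux cx.
    have := finset.in_set0 x; rewrite -(eqP up) 2!inE xe andbT negb_or => /negbT.
    rewrite -negb_or negbK !inE => /orP[]/eqP e; subst x.
      exact: (morse_exclusive sc fM tu ux').
    by move: us; rewrite (lower_exception_inj fM tK ux' sl) eqxx.
  move: (xe); rewrite inE => /and4P[xK ux cx le].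
  have ux' : u \in upper_exceptions K f x by rewrite inE uK ux cx.
  have := finset.in_set0 x; rewrite -(eqP lo) 2!inE xe andbT negb_or => /negbT.
  rewrite -negb_or negbK !inE => /orP[]/eqP e; subst x.
    by move: ut; rewrite (upper_exception_inj fM sK ux' tu) eqxx.
  exact: (morse_exclusive sc fM ux' sl).
have cardL : #|L| < n.
  apply: leq_trans leKn; apply: fintype.proper_card; rewrite finset.properEneq LK andbT.
  by apply/eqP => /setP/(_ s); rewrite memL eqxx sK.
have : collapsible L by apply: IH; rewrite ?cL.
case/existsP=> v cv; apply/existsP; exists v; apply: connect_trans cv.
apply: connect1; apply/exists_inP; exists s => //; apply/exists_inP; exists t => //.
by rewrite free !eqxx.
Qed.

(* Since [#|K|] is odd, so is the number of critical faces. *)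
Lemma noncollapsible_morse_vector K : simplicial_complex K -> odd #|K| ->
  ~ collapsible K -> discrete_morse_function K f -> 3 <= sumn (morse_vector K f).
Proof.
move=> sc oK nc fM; rewrite (sumn_morse_vector sc).
move: oK; rewrite (morse_parity sc fM); have := @morse_collapsible K sc fM.
by case: #|_| => [|[|[|]]] // /(_ erefl).
Qed.

End Forman.

(** * Building a complex face by face *)

Section Building.
Local Open Scope set_scope.
Local Notation set0 := finset.set0.
Variable V : finType.
Implicit Types (K L : {set {set V}}) (s t u : {set V}).
Implicit Types (b : {set V} * {set V}) (B : seq ({set V} * {set V})).

(* A block [(s, t)] adds the free face [s] of [t] together with [t];
   [(set0, t)] adds the critical face [t] alone. *)
Definition block_faces b : {set {set V}} :=
  if b.1 == set0 then [set b.2] else [set b.1; b.2].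

Definition fits L b : bool :=
  [&& b.2 \notin L, b.1 \notin L, b.2 != set0,
      [forall w in b.2, [|| b.2 :\ w == set0, b.2 :\ w == b.1 | b.2 :\ w \in L]] &
      (b.1 == set0) || [exists w in b.2, b.1 == b.2 :\ w]].

Fixpoint builds L B : bool :=
  if B is b :: B' then fits L b && builds (block_faces b :|: L) B' else true.

Fixpoint built L B : {set {set V}} :=
  if B is b :: B' then built (block_faces b :|: L) B' else L.

Lemma builds_cat L B1 B2 :
  builds L (B1 ++ B2) = builds L B1 && builds (built L B1) B2.
Proof. by elim: B1 L => //= b B1 IH L; rewrite IH andbA. Qed.

Lemma built_cat L B1 B2 : built L (B1 ++ B2) = built (built L B1) B2.
Proof. by elim: B1 L => //= b B1 IH L; rewrite IH. Qed.

Lemma mem_built L B s :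
  (s \in built L B) = (s \in L) || has (fun b => s \in block_faces b) B.
Proof.
elim: B L => [|b B IH] L /=; first by rewrite orbF.
by rewrite IH finset.in_setU -orbA orbCA.
Qed.

Lemma proper_sub_facet s t : s \proper t -> exists2 w, w \in t & s \subset t :\ w.
Proof.
case/properP=> st [w wt ws]; exists w => //.
by apply/fintype.subsetP => v vs; rewrite !inE (fintype.subsetP st) // andbT;
   apply: contraNneq ws => <-.
Qed.

(** [fits] looks up only the facets of [b.2]; smaller faces come from the closedness of [L]. A
    proper face of [b.1 = b.2 :\ x] lies in a facet [b.2 :\ w] with [w != x], hence in [L]. *)
Lemma fits_complex L b :
  simplicial_complex L -> fits L b -> simplicial_complex (block_faces b :|: L).
Proof.
move=> [L0 Lc] /and5P[b2L b1L b2N /forall_inP facet shape].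
have old u w : w \in b.2 -> u \subset b.2 :\ w -> b.2 :\ w != b.1 -> u != set0 -> u \in L.
  move=> wb uw wN uN; have := facet w wb; rewrite (negPf wN) /=.
  case/orP=> [/eqP w0|wL]; last exact: Lc wL uw uN.
  by move: uw uN; rewrite w0 finset.subset0 => ->.
have b1_sub u : b.1 != set0 -> u \subset b.1 -> u != b.1 -> u != set0 -> u \in L.
  move=> b1N ub uNb uN.
  have [w wb1 uw] : exists2 w, w \in b.1 & u \subset b.1 :\ w.
    by apply: proper_sub_facet; rewrite finset.properEneq uNb.
  case/orP: shape => [/eqP e|/exists_inP[x xb /eqP b1E]]; first by rewrite e eqxx in b1N.
  have wb : w \in b.2 by move: wb1; rewrite b1E !inE => /andP[].
  have wx : w != x by move: wb1; rewrite b1E !inE => /andP[].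
  apply: (old u w) => //.
    by apply: (fintype.subset_trans uw); rewrite b1E finset.setSD // finset.subsetDl.
  apply/eqP => /setP/(_ x); rewrite b1E !inE eqxx xb eq_sym wx //.
split=> [|t' u]; first rewrite finset.in_setU negb_or L0 andbT /block_faces.
  by case: ifP => b10; rewrite !inE ?negb_or eq_sym ?b10 //= eq_sym.
rewrite !finset.in_setU => /orP[|tL ut uN]; last by rewrite (Lc _ _ tL) ?orbT.
have inb1 : b.1 != set0 -> b.1 \in block_faces b.
  by move=> /negPf e; rewrite /block_faces e !inE eqxx.
have inb2 : b.2 \in block_faces b.
  by rewrite /block_faces; case: ifP => _; rewrite !inE eqxx ?orbT.
suff main : t' = b.2 \/ (b.1 != set0 /\ t' = b.1) ->
    u \subset t' -> u != set0 -> (u \in block_faces b) || (u \in L).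
  rewrite /block_faces => tb; apply: main; move: tb.
  case: ifP => [_|/negbT b1N]; rewrite !inE; first by move/eqP; left.
  by case/orP=> /eqP; [right|left].
case=> [->|[b1N ->]] us uN.
  have [->|uNb] := eqVneq u b.2; first by rewrite inb2.
  have [w wb uw] : exists2 w, w \in b.2 & u \subset b.2 :\ w.
    by apply: proper_sub_facet; rewrite finset.properEneq uNb.
  have [e|wN] := eqVneq (b.2 :\ w) b.1; last by rewrite (old u w) ?orbT.
  have b1N : b.1 != set0 by apply: contraNneq uN => e0; rewrite -finset.subset0 -e0 -e.
  have [->|uN1] := eqVneq u b.1; first by rewrite inb1.
  by rewrite (b1_sub u) ?orbT // -e.
have [->|uN1] := eqVneq u b.1; first by rewrite inb1.
by rewrite (b1_sub u) ?orbT.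
Qed.

Lemma builds_complex L B :
  simplicial_complex L -> builds L B -> simplicial_complex (built L B).
Proof.
elim: B L => //= b B IH L sL /andP[fb bB].
by apply: IH => //; exact: fits_complex.
Qed.

Lemma simplicial_complex0 : simplicial_complex (set0 : {set {set V}}).
Proof. by split=> [|s t]; rewrite inE. Qed.

Lemma fits_disjoint L b s : simplicial_complex L -> fits L b -> s \in block_faces b -> s \notin L.
Proof.
move=> sL /and5P[b2L b1L _ _ _]; rewrite /block_faces.
by case: ifP => _; rewrite !inE; [move/eqP->|case/orP=> /eqP->].
Qed.

Lemma fits_pair L b : fits L b -> b.1 != set0 -> b.1 \subset b.2 /\ #|b.2| = #|b.1|.+1.
Proof.
move=> /and5P[_ _ _ _ /orP[->//|/exists_inP[w wb /eqP b1E]]] _.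
by rewrite b1E finset.subsetDl (cardsD1 w b.2) wb.
Qed.

(** * The discrete Morse function of a build order *)

Section MorseFunction.
Variables (B : seq ({set V} * {set V})) (R : realType).
Hypothesis Bok : builds set0 B.
Let K := built set0 B.
Let idx s := find (fun b => s \in block_faces b) B.
Let blk s := nth (set0, set0) B (idx s).

Let memK s : (s \in K) = has (fun b => s \in block_faces b) B.
Proof. by rewrite mem_built inE. Qed.

Let stage i := built set0 (take i B).

Let mem_stage s i : (s \in stage i) = (idx s < i)%N && (s \in K).
Proof.
rewrite memK mem_built inE /= /idx.
have [hs|hs] := boolP (has _ B); last first.
  rewrite andbF; apply: contraNF hs => /hasP[b bt sb].
  by apply/hasP; exists b => //; exact: mem_take bt.
by rewrite andbT has_take.
Qed.

Let stage_complex i : simplicial_complex (stage i).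
Proof.
apply: builds_complex; first exact: simplicial_complex0.
by move: Bok; rewrite -{1}(cat_take_drop i B) builds_cat => /andP[].
Qed.

Let stage_fits i : (i < size B)%N -> fits (stage i) (nth (set0, set0) B i).
Proof.
move=> iB; move: Bok; rewrite -{1}(cat_take_drop i B) builds_cat => /andP[_].
by rewrite (drop_nth (set0, set0) iB) /= => /andP[].
Qed.

Let blk_in s : s \in K -> [/\ (idx s < size B)%N, s \in block_faces (blk s), blk s \in B & fits (stage (idx s)) (blk s)].
Proof.
rewrite memK => hs; have lt : (idx s < size B)%N by rewrite -has_find.
by have nf := nth_find (set0, set0) hs; split=> //; [exact: mem_nth|exact: stage_fits].
Qed.

Let blk_uniq s b : b \in B -> s \in block_faces b -> blk s = b.
Proof.
move=> bB sb; have sK : s \in K by rewrite memK; apply/hasP; exists b.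
have ib : (index b B < size B)%N by rewrite index_mem.
rewrite /blk; suff -> : idx s = index b B by rewrite nth_index.
apply/eqP; rewrite eqn_leq; apply/andP; split.
  rewrite leqNgt; apply/negP => /(before_find (set0, set0)).
  by rewrite nth_index // sb.
have := stage_fits ib; rewrite nth_index // => fb.
have := fits_disjoint (stage_complex _) fb sb.
by rewrite mem_stage sK andbT -leqNgt.
Qed.

(** The blocks up to that of [t] form a complex containing [t], so every face of [t] appears no
    later than [t]. Inside one block the only proper inclusion is that of the pair. *)
Let idx_face s t : s \in K -> t \in K -> s \proper t ->
  (idx s < idx t)%N \/ (idx s = idx t /\ blk t = (s, t)).
Proof.
move=> sK tK st; have [it tb _ ft] := blk_in tK; have [_ sb _ _] := blk_in sK.
have : s \in stage (idx t).+1.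
  have [_ cl] := stage_complex (idx t).+1; apply: (cl t).
  - by rewrite mem_stage ltnS leqnn.
  - by case/andP: st.
  - by apply: contraTneq sK => ->; have [+ _] := stage_complex (size B); rewrite /stage take_size.
rewrite mem_stage sK andbT ltnS leq_eqVlt => /orP[/eqP e|]; last by left.
right; split=> //; move: sb; rewrite /blk e -/(blk t).
move: tb ft; case: (blk t) => [x y]; rewrite /block_faces /=.
case: ifP => [_|/negbT xN]; rewrite !inE.
  by move=> /eqP ty _ /eqP sy; move: st; rewrite ty sy fintype.properxx.
move=> tb fb; have [/= xy cxy] := fits_pair fb xN.
have ts : t != s by apply: contraTneq st => ->; rewrite fintype.properxx.
case/orP: tb ts st => /eqP-> ts st /orP[]/eqP E; move: ts st; rewrite E ?eqxx //.
by move=> _ /fintype.proper_card; rewrite cxy ltnNge leqnSn.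
Qed.

(** The two members of a pair tie, which makes each an exception of the other; along every other
    proper inclusion the value strictly increases. *)
Let f s : R := (idx s)%:R%R.

Let K0 : set0 \notin K.
Proof. by have [] := builds_complex simplicial_complex0 Bok. Qed.

Let card_proper s t : s \subset t -> #|t| = #|s|.+1 -> s \proper t.
Proof. by move=> st c; rewrite finset.properEcard st c ltnSn. Qed.

Let upper_sub s t : s \in K -> t \in upper_exceptions K f s -> blk s = (s, t).
Proof.
move=> sK; rewrite inE => /and4P[tK st /eqP c]; rewrite /f ler_nat => le.
have [|[e]] := idx_face sK tK (card_proper st c); first by rewrite ltnNge le.
by rewrite /blk e.
Qed.

Let lower_sub s t : t \in K -> s \in lower_exceptions K f t -> blk t = (s, t).
Proof.
move=> tK; rewrite inE => /and4P[sK st /eqP c]; rewrite /f ler_nat => le.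
have [|[e]//] := idx_face sK tK (card_proper st c); first by rewrite ltnNge le.
Qed.

Let fM : discrete_morse_function K f.
Proof.
move=> s sK; split.
  apply: (@leq_trans #|[set (blk s).2]|); last by rewrite cards1.
  by apply/subset_leq_card/fintype.subsetP => t /(upper_sub sK) ->; rewrite !inE.
apply: (@leq_trans #|[set (blk s).1]|); last by rewrite cards1.
by apply/subset_leq_card/fintype.subsetP => t /(lower_sub sK) ->; rewrite !inE.
Qed.

Let critE s : critical K f s = ((set0, s) \in B).
Proof.
apply/idP/idP.
  case/and3P=> sK /eqP up /eqP lo; have [_ sb bB fb] := blk_in sK.
  case: (eqVneq (blk s).1 set0) sb => [b1|b1N].
    rewrite /block_faces b1 eqxx inE => /eqP e.
    by move: bB; rewrite (surjective_pairing (blk s)) b1 -e.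
  have [sub c] := fits_pair fb b1N.
  have mem : (blk s).1 \in K /\ (blk s).2 \in K.
    by rewrite !memK; split; apply/hasP; exists (blk s); rewrite // /block_faces (negPf b1N) !inE eqxx ?orbT.
  (* A smaller index for the lower face would put it into the complex to which the block is added,
     against [fits_disjoint]. *)
  have same : f (blk s).1 = f (blk s).2.
    have [K1 K2] := mem; have [|[e _]] := idx_face K1 K2 (card_proper sub c); last by rewrite /f e.
    have e1 : blk (blk s).1 = blk s by apply: blk_uniq => //; rewrite /block_faces (negPf b1N) !inE eqxx.
    have e2 : blk (blk s).2 = blk s by apply: blk_uniq => //; rewrite /block_faces (negPf b1N) !inE eqxx orbT.
    have [+ _ _ _] := blk_in K1; have [+ _ _ _] := blk_in K2.
    move=> i2 i1 lt; have [_ _ _ f2] := blk_in K2.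
    have := fits_disjoint (s := (blk s).1) (stage_complex _) f2; rewrite e2 /block_faces (negPf b1N) !inE eqxx.
    by move=> /(_ isT); rewrite mem_stage lt K1.
  have up_ex : (blk s).2 \in upper_exceptions K f (blk s).1.
    by rewrite inE mem.2 sub c eqxx same lexx.
  have lo_ex : (blk s).1 \in lower_exceptions K f (blk s).2.
    by rewrite inE mem.1 sub c eqxx same lexx.
  rewrite /block_faces (negPf b1N) !inE => /orP[]/eqP e; exfalso.
    by move: up_ex; rewrite -e up inE.
  by move: lo_ex; rewrite -e lo inE.
move=> bB; have sb : s \in block_faces (set0, s) by rewrite /block_faces /= eqxx inE.
have e := blk_uniq bB sb.
have sK : s \in K by rewrite memK; apply/hasP; exists (set0, s).
apply/and3P; split=> //; rewrite -finset.subset0; apply/fintype.subsetP => t.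
  move=> /(upper_sub sK); rewrite e => -[s0 _].
  by rewrite -s0 (negPf K0) in sK.
move=> tl; have := lower_sub sK tl; rewrite e => -[t0].
by move: tl; rewrite -t0 inE (negPf K0).
Qed.

(** Since top faces do not repeat, critical faces can be counted along the list. *)
Let uniq_tops L C : builds L C -> uniq (map snd C) /\ forall b, b \in C -> b.2 \notin L.
Proof.
elim: C L => //= b C IH L /andP[/and5P[b2L _ _ _ _] /IH[uC notin]].
have b2 : b.2 \in block_faces b by rewrite /block_faces; case: ifP; rewrite !inE eqxx ?orbT.
split; first rewrite uC andbT.
  by apply/negP => /mapP[c cC e]; have := notin c cC; rewrite -e finset.in_setU b2.
move=> c; rewrite inE => /orP[/eqP-> //|cC].
by apply: contra (notin c cC) => cL; rewrite finset.in_setU cL orbT.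
Qed.

Lemma building_morse_vector :
  is_discrete_morse_vector R K
    (mkseq (fun i => count (fun b => (b.1 == set0) && (#|b.2| == i.+1)) B)
           (dimension K).+1).
Proof.
exists f => //; rewrite /morse_vector; apply: eq_mkseq => i.
rewrite -size_filter -(size_map snd); set l := map _ _.
have ul : uniq l.
  by apply: subseq_uniq (uniq_tops Bok).1; apply: map_subseq; exact: filter_subseq.
rewrite -(card_uniqP ul); apply: eq_card => s; rewrite inE critE.
apply/andP/mapP => [[bB c]|[[x y]]].
  by exists (set0, s); rewrite // mem_filter eqxx c.
by rewrite mem_filter /= => /andP[/andP[/eqP-> c] yB] ->.
Qed.

End MorseFunction.
End Building.

(** * Noncollapsibility *)

Section Noncollapsible.

(** Removing a free vertex with its edge, or a free edge with its triangle, takes one from each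
    side. *)
Let euler_drop a b c k : 0 < k <= 2 ->
  (k == 1) + ((k.+1 == 1) + a) + ((k == 3) + ((k.+1 == 3) + b)) <= (k == 2) + ((k.+1 == 2) + c) ->
  a + b <= c.
Proof. by case: k => [|[|[|]]] //= _; lia. Qed.

Local Open Scope set_scope.
Local Notation set0 := finset.set0.
Variables (V : finType) (K Y D : {set {set V}}) (o p : V).
Implicit Types (L G : {set {set V}}) (s t u : {set V}) (S : {set V}).

(** Connectedness of the graph of [G], stated with cuts instead of paths: under a collapse it is
    enough to adjust the cut or to replace one crossing edge. *)
Definition cut_connected G : Prop := forall S x y,
  x \in S -> y \notin S -> [set x] \in G -> [set y] \in G ->
  exists x' y', [/\ x' \in S, y' \notin S & [set x'; y'] \in G].

Let size_count G i := #|[set s in G | #|s| == i]|.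

Hypothesis sc_K : simplicial_complex K.
Hypothesis YK : Y \subset K.
Hypothesis Y_closed : forall s t, t \in Y -> s \subset t -> s != set0 -> s \in Y.
Hypothesis Y_protected : forall s, s \in Y -> s != [set o; p] ->
  (forall t, t \in K -> ~~ (s \proper t)) \/
  exists t1 t2, [/\ t1 \in Y, t2 \in Y, t1 != t2, s \proper t1 & s \proper t2].
Hypothesis aY : exists2 t, t \in Y & [set o; p] \proper t.
Hypothesis D_closed : forall s t, t \in D -> s \subset t -> s != set0 -> s \in D.
Hypothesis D_face : forall s, s \in D -> [/\ o \notin s, #|s| <= 3 & o |: s \in K].
Hypothesis D_protected : forall s, s \in D -> #|s| <= 2 -> s \in Y.
Hypothesis D_no_free : forall s, s \in D -> #|s| <= 2 ->
  exists t1 t2, [/\ t1 \in D, t2 \in D, t1 != t2, s \proper t1 & s \proper t2].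
Hypothesis pD : [set p] \in D.
Hypothesis D_connected : cut_connected D.
Hypothesis D_euler : size_count D 1 + size_count D 3 <= (size_count D 2).+1.
Hypothesis star_o : forall t, t \in K -> o \in t -> t \in Y \/ t :\ o \in D.
(** The coface of [[set o; p]] in [Y] thus differs from its cofaces in the cone over [D]. *)
Hypothesis Y_star_o : forall t, t \in Y -> o \in t -> t :\ o \in D -> t = [set o; p].

Let link L := [set s in D | o |: s \in L].

(* Either the cone over [D] is still intact, and then nothing in it is free,
   or the link of [o] in it is connected of Euler characteristic at most 0, so
   that it is never the single vertex [p]; either way [[set o; p]] is not free. *)
Let invariant L := [/\ simplicial_complex L, L \subset K, Y \subset L,
  cut_connected (link L) &
  link L = D \/ size_count (link L) 1 + size_count (link L) 3 <= size_count (link L) 2].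

Let op : o != p.
Proof. by have [+ _ _] := D_face pD; rewrite inE. Qed.

Let aYin : [set o; p] \in Y.
Proof.
have [t tY /fintype.proper_sub at_] := aY; apply: Y_closed tY at_ _.
by rewrite -card_gt0 cards2.
Qed.

Let link_closed L s t : simplicial_complex L -> t \in link L -> s \subset t -> s != set0 -> s \in link L.
Proof.
move=> [_ cl]; rewrite !inE => /andP[tD otL] st sN; rewrite (D_closed tD st sN) /=.
apply: cl otL _ _; first exact: finset.setUS.
by apply/set0Pn; exists o; rewrite !inE eqxx.
Qed.

(** This yields a coface of [[set o; p]] in the cone, besides the one in [Y]. In an intact link it
    exists because [D] has no free face. Otherwise an isolated [p] would be the whole connected
    link, while the Euler bound forces an edge. *)
Let p_edge L : invariant L -> exists2 v, v != p & [set p; v] \in link L.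
Proof.
move=> [sL _ YL cut]; have pL : [set p] \in link L.
  by rewrite inE pD; exact: fintype.subsetP YL _ aYin.
case=> [LD|euler].
  have [|t [_ [tD _ _ /fintype.properP[pt [v vt vp]] _]]] := D_no_free pD; first by rewrite cards1.
  exists v; first by rewrite inE in vp.
  rewrite LD; apply: D_closed tD _ _; last by rewrite -card_gt0 cards2 eq_sym; case: (_ == _).
  by rewrite finset.subUset pt finset.sub1set.
have [v /andP[vp vL]|none] := pickP (fun v => (v != p) && ([set v] \in link L)).
  have [x [y [xp yp xyL]]] := cut [set p] p v (finset.set11 p) (etrans (congr1 negb (finset.in_set1 v p)) vp) pL vL.
  exists y; first by rewrite inE in yp.
  by move: xp; rewrite inE => /eqP <-.
have : 0 < size_count (link L) 2.
  apply: leq_trans euler; rewrite ltn_addr // card_gt0; apply/set0Pn; exists [set p].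
  by rewrite inE pL cards1.
rewrite card_gt0 => /set0Pn[e]; rewrite inE => /andP[eL /cards2P[x [y [xy eE]]]].
have xL : [set x] \in link L by apply: (link_closed sL eL); rewrite ?eE ?finset.subsetUl // -card_gt0 cards1.
have yL : [set y] \in link L by apply: (link_closed sL eL); rewrite ?eE ?finset.subsetUr // -card_gt0 cards1.
have := none x; have := none y; rewrite xL yL !andbT => /negbFE/eqP yp /negbFE/eqP xp.
by rewrite xp yp eqxx in xy.
Qed.

Let count_D1 G s i : s \in G -> size_count G i = (#|s| == i) + size_count (G :\ s) i.
Proof.
move=> sG; rewrite /size_count (cardsD1 s) inE sG; congr (_ + #|pred_of_set _|).
by apply/setP => t; rewrite !inE andbA.
Qed.

Let card_o s : o \in s -> #|s| = #|s :\ o|.+1.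
Proof. by move=> os; rewrite (cardsD1 o s) os. Qed.

(** As [[set o; p]] has two cofaces, [s] lies outside [Y], and so does [t]. The link of [o] then
    undergoes a collapse, loses a triangle, or stays the same, according to whether [o] lies in [s],
    only in [t], or in neither. *)
Let invariant_collapse L L' : invariant L -> elementary_collapse L L' -> invariant L'.
Proof.
move=> IL; have [v vp pv] := p_edge IL; move: (IL) => [sL LK YL cut euler].
case/exists_inP=> s sinL /exists_inP[t tL /andP[/eqP free /eqP L'E]].
have ct := free_face_card sL free; have sL' := collapse_complex sL free.
rewrite -L'E in sL'.
have cof u : u \in L -> s \proper u -> u = t.
  by move=> uL su; apply/eqP; rewrite -finset.in_set1 -free inE uL.
have st : s \proper t.
  have : t \in [set u in L | s \proper u] by rewrite free inE.
  by rewrite inE => /andP[].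
have two u1 u2 : u1 \in L -> u2 \in L -> s \proper u1 -> s \proper u2 -> u1 = u2.
  by move=> u1L u2L su1 su2; rewrite (cof u1) // (cof u2).
have sN : s != set0 by apply: contraNneq sL.1 => <-.
have sa : s != [set o; p].
  apply/eqP => sE; have [u uY au] := aY.
  have opvL : o |: [set p; v] \in L by move: pv; rewrite inE => /andP[].
  have vo : v != o.
    by have := pv; rewrite inE => /andP[/D_face[+ _ _] _]; rewrite !inE negb_or eq_sym [o == v]eq_sym => /andP[].
  have e : u = o |: [set p; v].
    apply: two; rewrite ?sE //; first exact: fintype.subsetP YL _ uY.
    apply/fintype.properP; split; first by rewrite finset.setUA finset.subsetUl.
    by exists v; rewrite !inE ?eqxx ?orbT // negb_or vo vp.
  have ou : o \in u by rewrite e !inE eqxx.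
  have uD : u :\ o \in D.
    rewrite e finset.setU1K; first by move: pv; rewrite inE => /andP[].
    by rewrite !inE negb_or op eq_sym vo.
  by move: au; rewrite (Y_star_o uY ou uD) fintype.properxx.
have sY : s \notin Y.
  apply/negP => sY; case: (Y_protected sY sa) => [none|[t1 [t2 [t1Y t2Y + st1 st2]]]].
    by have := none t (fintype.subsetP LK _ tL); rewrite st.
  by rewrite (two t1 t2) ?eqxx //; apply: (fintype.subsetP YL).
have tY : t \notin Y by apply: contra sY => tY; exact: Y_closed tY (fintype.proper_sub st) sN.
have memL' u : (u \in L') = [&& u != s, u != t & u \in L] by rewrite L'E !inE negb_or andbA.
have LK' : L' \subset K.
  by apply/fintype.subsetP => u; rewrite memL' => /and3P[_ _]; exact: fintype.subsetP LK u.
have YL' : Y \subset L'.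
  apply/fintype.subsetP => u uY; rewrite memL' (fintype.subsetP YL _ uY) andbT.
  by apply/andP; split; [apply: contraNneq sY|apply: contraNneq tY] => <-.
have oU1 u : u \in D -> (o |: u) :\ o = u.
  by move=> /D_face[ou _ _]; rewrite finset.setU1K.
have tD : o \in t -> t :\ o \in D.
  by move=> ot; have [tY'|//] := star_o (fintype.subsetP LK _ tL) ot; rewrite tY' in tY.
(* Case [o \in s]: without [o] the pair is an elementary collapse of the link, so the link was not
   [D]. *)
have [os|os] := boolP (o \in s).
  have ot : o \in t by exact: fintype.subsetP (fintype.proper_sub st) _ os.
  have sD : s :\ o \in D.
    by have [sY'|//] := star_o (fintype.subsetP LK _ sinL) os; rewrite sY' in sY.
  have {}tD := tD ot.
  move: (s :\ o) (t :\ o) (finset.setD1K os) (finset.setD1K ot) sD tD => x y sE tE xD yD.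
  have [ox cx oxK] := D_face xD; have [oy cy oyK] := D_face yD.
  have xN : x != set0.
    apply: contraNneq sY => x0; rewrite -sE x0 finset.setU0.
    by apply: Y_closed aYin _ _; rewrite ?finset.subsetUl // -card_gt0 cards1.
  have cxy : #|y| = #|x|.+1 by move: ct; rewrite -sE -tE !cardsU1 ox oy => -[].
  have xL : x \in link L by rewrite inE xD sE.
  have yL : y \in link L by rewrite inE yD tE.
  have xy : x \subset y.
    by have := fintype.proper_sub st; rewrite -sE -tE => /(finset.setSD [set o]); rewrite !finset.setU1K.
  have cofx u : u \in link L -> x \proper u -> u = y.
    rewrite inE => /andP[uD uL] xu; have [ou _ _] := D_face uD.
    rewrite -(oU1 u uD) -(oU1 y yD) tE; congr (_ :\ o); apply: cof => //.
    rewrite -sE finset.properEneq; apply/andP; split.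
      apply: contraTneq xu => e; rewrite -(oU1 x xD) e oU1 //; by rewrite fintype.properxx.
    by apply: finset.setUS; exact: fintype.proper_sub.
  have linkE : link L' = link L :\ x :\ y.
    apply/setP => u; rewrite !inE memL'; case uD: (u \in D); rewrite ?andbF //=.
    have eqo z : z \in D -> (o |: u == o |: z) = (u == z).
      move=> zD; apply/eqP/eqP => [e|-> //].
      by rewrite -(oU1 u uD) -(oU1 z zD) e.
    by rewrite -sE -tE !eqo //; case: (u == x); case: (u == y).
  have c2 : #|x| <= 2 by rewrite -ltnS -cxy.
  case: euler => [LD|euler].
    have [t1 [t2 [t1D t2D + xt1 xt2]]] := D_no_free xD c2.
    have e1 : t1 = y by apply: cofx xt1; rewrite LD.
    have e2 : t2 = y by apply: cofx xt2; rewrite LD.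
    by rewrite e1 e2 eqxx.
  have yx : y \in link L :\ x.
    by rewrite in_setD1 yL andbT; apply/eqP => e; move: cxy; rewrite e; exact: n_Sn.
  split=> //; last first.
    right; rewrite linkE; move: euler; rewrite !(count_D1 _ xL) !(count_D1 _ yx) cxy.
    by apply: euler_drop; rewrite card_gt0 xN.
  rewrite linkE => S a b aS bS; rewrite !in_setD1 => /and3P[ay ax aL] /and3P[by_ bx bL].
  have c1 : #|x| = 1 \/ #|x| = 2.
    by move: xN; rewrite -card_gt0; case: #|x| c2 => [|[|[|]]] //; [left|right].
  case: c1 => [/eqP/cards1P[v0 xE]|/eqP/cards2P[x1 [x2 [x12 xE]]]].
    (* A leaf [v0] with neighbour [w] is removed. Moving [v0] to the side of [w] in the cut makes
       the crossing edge avoid [v0]. *)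
    have [w yw] : exists w, y = [set v0; w].
      move/eqP: cxy; rewrite xE cards1 => /cards2P[w1 [w2 [_ e]]].
      move: xy; rewrite xE e finset.sub1set !inE => /orP[]/eqP->; first by exists w2.
      by exists w1; rewrite finset.setUC.
    have v0a : v0 != a by apply: contraNneq ax => <-; rewrite xE.
    have v0b : v0 != b by apply: contraNneq bx => <-; rewrite xE.
    have v0w : v0 != w.
      by apply/eqP => e; move: cxy; rewrite xE yw -e cards1 cards2 eqxx.
    have nbr z : [set v0; z] \in link L -> z != v0 -> z = w.
      move=> zL zv; have : [set v0; z] = y.
        apply: cofx => //; rewrite xE; apply/fintype.properP; split; first exact: finset.subsetUl.
        by exists z; rewrite !inE ?eqxx ?orbT.
      rewrite yw => /setP/(_ z); rewrite !inE eqxx orbT (negPf zv) /=.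
      by move/esym/eqP.
    pose S' := if w \in S then v0 |: S else S :\ v0.
    have S'E z : z != v0 -> (z \in S') = (z \in S).
      by move=> zv; rewrite /S'; case: ifP => _; rewrite !inE (negPf zv).
    have v0S' : (v0 \in S') = (w \in S) by rewrite /S'; case: ifP => _; rewrite !inE eqxx.
    have aS' : a \in S' by rewrite S'E // eq_sym.
    have bS' : b \notin S' by rewrite S'E // eq_sym.
    have [x' [y' [x'S y'S xyL]]] := cut S' a b aS' bS' aL bL.
    have x'v : x' != v0.
      apply/eqP => e; subst x'; move: y'S.
      have [->|y'v] := eqVneq y' v0; first by rewrite x'S.
      by rewrite S'E // (nbr y') // -v0S' x'S.
    have y'v : y' != v0.
      apply/eqP => e; subst y'; move: y'S; rewrite v0S' -(nbr x') //; last by rewrite finset.setUC.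
      by rewrite -S'E // x'S.
    exists x', y'; rewrite -!S'E //; split=> //; rewrite !in_setD1 xyL andbT.
    apply/andP; split; apply/eqP => /setP/(_ v0).
      by rewrite yw !inE eqxx eq_sym (negPf x'v) eq_sym (negPf y'v).
    by rewrite xE !inE eqxx eq_sym (negPf x'v) eq_sym (negPf y'v).
  (* An edge is removed with its triangle, whose third vertex is [z]. If that edge was the crossing
     one, another edge of the triangle crosses the cut. *)
  have [z [yE zx1 zx2]] : exists z, [/\ y = [set x1; x2; z], z != x1 & z != x2].
    have : x \proper y by rewrite finset.properEcard xy cxy ltnSn.
    case/fintype.properP=> _ [z zy]; rewrite xE !inE negb_or => /andP[z1 z2].
    exists z; split=> //; apply/esym/eqP; rewrite finset.eqEcard cxy xE cards2 x12.
    rewrite finset.subUset -xE xy finset.sub1set zy /= finset.setUC cardsU1 xE.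
    by rewrite !inE negb_or z1 z2 cards2 x12.
  have edge (u w : V) : [set u; w] \in link L -> [set u; w] != x -> [set u; w] \in link L :\ x :\ y.
    move=> uL ux; rewrite !in_setD1 ux uL !andbT; apply/eqP => e.
    by move: cxy; rewrite -e xE !cards2 x12; case: (_ == _).
  have zL (u : V) : u \in y -> [set u; z] \in link L.
    move=> uy; apply: (link_closed sL yL); last by rewrite -card_gt0 cards2; case: (_ == _).
    by rewrite finset.subUset !finset.sub1set uy yE !inE eqxx orbT.
  have zN (u : V) : [set u; z] != x.
    by apply/eqP => /setP/(_ z); rewrite xE !inE eqxx orbT (negPf zx1) (negPf zx2).
  have [x' [y' [x'S y'S xyL]]] := cut S a b aS bS aL bL.
  have [e|ne] := eqVneq [set x'; y'] x; last by exists x', y'; split=> //; exact: edge.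
  have x'y : x' \in y by apply: (fintype.subsetP xy); rewrite -e !inE eqxx.
  have y'y : y' \in y by apply: (fintype.subsetP xy); rewrite -e !inE eqxx orbT.
  have [zS|zS] := boolP (z \in S); last by exists x', z; split=> //; apply: edge; rewrite ?zL.
  by exists z, y'; rewrite finset.setUC; split=> //; apply: edge; rewrite ?zL.
(* Case [o \notin s]: the link changes only if [t] contains [o], and then [t] is the cone over
   [s]. *)
have [ot|ot] := boolP (o \in t); last first.
  have linkE : link L' = link L.
    apply/setP => u; rewrite !inE memL'; case: (u \in D) => //=.
    have -> : o |: u != s by apply: contraNneq os => <-; rewrite !inE eqxx.
    by have -> : o |: u != t by apply: contraNneq ot => <-; rewrite !inE eqxx.
  by split; rewrite ?linkE.
have tE : t :\ o = s.
  apply/esym/eqP; rewrite finset.eqEcard; apply/andP; split; last by rewrite -ltnS -ct -card_o.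
  apply/fintype.subsetP => z zs; rewrite !inE (fintype.subsetP (fintype.proper_sub st)) // andbT.
  by apply: contraNneq os => <-.
have sD : s \in D by rewrite -tE tD.
have os_t : o |: s = t by rewrite -tE finset.setD1K.
(* Smaller faces of [D] lie in [Y], so [s] is a triangle and the link keeps its vertices and
   edges. *)
have cs : #|s| = 3.
  have [_ + _] := D_face sD; rewrite leq_eqVlt => /orP[/eqP//|c2].
  by have := D_protected sD c2; rewrite (negPf sY).
have sl : s \in link L by rewrite inE sD os_t.
have linkE : link L' = link L :\ s.
  apply/setP => u; rewrite !inE memL'; case uD: (u \in D); rewrite ?andbF //=.
  have -> : o |: u != s by apply: contraNneq os => <-; rewrite !inE eqxx.
  rewrite -os_t /=; congr (~~ _ && _); apply/eqP/eqP => [e|-> //].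
  by rewrite -(oU1 u uD) -(oU1 s sD) e.
have keep u : u \in link L -> #|u| != 3 -> u \in link L'.
  by move=> uL cu; rewrite linkE in_setD1 uL andbT; apply: contraNneq cu => ->; rewrite cs.
split=> //.
  move=> S a b aS bS; rewrite linkE !in_setD1 => /andP[_ aL] /andP[_ bL].
  have [x' [y' [x'S y'S xyL]]] := cut S a b aS bS aL bL.
  exists x', y'; split=> //; rewrite -linkE; apply: keep => //.
  by rewrite cards2; case: (x' == y').
(* Losing a triangle lowers the Euler characteristic by one, so the bound 1 for an intact [D]
   becomes 0. *)
right; rewrite linkE.
have e1 := count_D1 1 sl; have e2 := count_D1 2 sl; have e3 := count_D1 3 sl.
rewrite cs /= add0n in e1 e2 e3.
case: euler => [LD|]; last by rewrite e1 e2 e3 add1n addnS => /ltnW.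
by have := D_euler; rewrite -{1 2 3}LD e1 e2 e3 add1n addnS ltnS.
Qed.

Theorem cone_noncollapsible : ~ collapsible K.
Proof.
case/existsP=> v /connectP[q qp qL].
(* Every complex reached contains [[set o; p]], so none is a single vertex. *)
suff [] : invariant (last K q).
  rewrite -qL => _ _ YL _ _; have := fintype.subsetP YL _ aYin.
  rewrite inE => /eqP/(congr1 (fun A : {set V} => #|A|)).
  by rewrite cards2 cards1 op.
have : invariant K.
  have linkK : link K = D.
    by apply/setP => s; rewrite inE; case sD: (s \in D) => //=; have [] := D_face sD.
  by split; rewrite ?linkK //; left.
elim: q K qp {qL} => //= L' q IH L /andP[LL' qp] IL.
by apply: (IH _ qp); exact: invariant_collapse LL'.
Qed.

End Noncollapsible.

(** * Contractibility of the realization *)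

Section Topology.
Local Open Scope ring_scope.
Variables (R : realType) (V : finType).
Local Notation X := {ptws V -> R}.

Lemma continuous_ptws (T : topologicalType) (f : T -> X) :
  (forall v, continuous (fun x => f x v : R)) -> continuous f.
Proof.
move=> cf x; apply/cvg_sup => v U [W [[W' oW' <-] W'fx WU]].
apply: (filterS WU); rewrite nbhs_simpl.
exact: (cf v x _ (open_nbhs_nbhs (conj oW' W'fx))).
Qed.

Lemma eval_continuous (v : V) : continuous (fun x : X => x v).
Proof. exact: (@proj_continuous V (fun=> R) v). Qed.

Lemma bigmin_continuous (T : topologicalType) (I : Type) (r : seq I)
    (P : pred I) (f : I -> T -> R) :
  (forall i, continuous (f i)) ->
  continuous (fun x => \big[Order.min/1]_(i <- r | P i) f i x).
Proof.
move=> cf x; elim: r => [|i r IHr].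
  under eq_fun do rewrite big_nil; exact: cvg_cst.
under eq_fun do rewrite big_cons.
by case: (P i) => //; exact: (continuous_min (cf i x) IHr).
Qed.

Lemma continuous_add (T : topologicalType) (f g : T -> R) :
  continuous f -> continuous g -> continuous (fun x => f x + g x).
Proof. by move=> cf cg x; exact: (cvgD (cf x) (cg x)). Qed.

Lemma continuous_sub (T : topologicalType) (f g : T -> R) :
  continuous f -> continuous g -> continuous (fun x => f x - g x).
Proof. by move=> cf cg x; exact: (cvgB (cf x) (cg x)). Qed.

Lemma continuous_mul (T : topologicalType) (f g : T -> R) :
  continuous f -> continuous g -> continuous (fun x => f x * g x).
Proof. by move=> cf cg x; exact: (cvgM (cf x) (cg x)). Qed.

Lemma continuous_comp2 (T U W : topologicalType) (f : T -> U) (g : U -> W) :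
  continuous f -> continuous g -> continuous (fun x => g (f x)).
Proof. by move=> cf cg x; exact: (continuous_comp (cf x) (cg (f x))). Qed.

Lemma continuous_pair (T U W : topologicalType) (f : T -> U) (g : T -> W) :
  continuous f -> continuous g -> continuous (fun x => (f x, g x)).
Proof. by move=> cf cg x; exact: (cvg_pair (cf x) (cg x)). Qed.

Lemma continuous_fst (T U : topologicalType) : continuous (@fst T U).
Proof. by move=> x; exact: cvg_fst. Qed.

Lemma continuous_snd (T U : topologicalType) : continuous (@snd T U).
Proof. by move=> x; exact: cvg_snd. Qed.

Lemma continuous_const (T U : topologicalType) (c : U) : continuous (fun _ : T => c).
Proof. by move=> x; exact: cvg_cst. Qed.

(** Continuity is required on the whole ambient space rather than within [A], so that homotopies
    compose without subspace topologies. *)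
Definition globally_contractible (A : set X) : Prop :=
  exists (a : X) (H : X * R -> X),
    [/\ A a, continuous H,
        forall x t, A x -> 0 <= t <= 1 -> A (H (x, t)),
        forall x, A x -> H (x, 0) = x &
        forall x, A x -> H (x, 1) = a].

Lemma globally_contractibleW A : globally_contractible A -> contractible R A.
Proof.
move=> [a [H [Aa cH HA H0 H1]]]; exists a, H; split=> //.
exact: continuous_subspaceT.
Qed.

(** * The deformation retraction of an elementary collapse *)

Section Push.
Variables (K L : {set {set V}}) (s : {set V}) (w : V).
Let t := (w |: s)%SET.
Hypotheses (sc_K : simplicial_complex K) (sc_L : simplicial_complex L).
Hypotheses (sN0 : s != finset.set0) (ws : w \notin s).
Hypothesis sL : s \notin L.
Hypothesis KE : K = (s |: (t |: L))%SET.

(** On [K] it is nonzero only in the interiors of [s] and [t]. The seed 1 does not disturb the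
    minimum, as barycentric coordinates are at most 1. *)
Let depth (x : X) : R := \big[Order.min/1]_(v in s) x v.
Let coef (v : V) : R := if v == w then #|s|%:R else if v \in s then -1 else 0.
(** Straight motion from [s] towards [w]: the coordinates on [s] fall equally and [w] gains the
    total. At time 1 the smallest coordinate on [s] vanishes, so the point has left the interiors of
    [s] and [t]; points of [L] have depth 0 and stay fixed. *)
Definition push (x : X) (u : R) : X := fun v => x v + u * depth x * coef v.

Let depth_le x v : v \in s -> depth x <= x v.
Proof. by move=> vs; apply: bigmin_inf vs _. Qed.

Let depth_ge0 x : (forall v, 0 <= x v) -> 0 <= depth x.
Proof. by move=> x0; apply: le_bigmin. Qed.

Let depth_attained x : realization R K x -> exists2 v, v \in s & depth x = x v.
Proof.
move=> [x0 x1 _]; have [v0 v0s] := set0Pn _ sN0.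
have [v vs xv] : exists2 v, v \in s & forall u, u \in s -> x v <= x u.
  case: (@arg_minP _ R V v0 (mem s) x v0s) => v vs xv.
  by exists v.
exists v => //; apply/eqP; rewrite eq_le depth_le //=.
apply: le_bigmin => //.
rewrite -x1 (bigD1 v) //= lerDl; apply: sumr_ge0 => *; exact: x0.
Qed.

Let coef_sum : \sum_v coef v = 0.
Proof.
rewrite (bigD1 w) //= {1}/coef eqxx (bigID (mem s)) /=.
rewrite [X in _ + (_ + X)]big1 ?addr0; last first.
  by move=> v /andP[/negPf vw /negPf vs]; rewrite /coef vw vs.
rewrite (eq_bigr (fun=> -1)); last first.
  by move=> v /andP[/negPf vw vs]; rewrite /coef vw vs.
rewrite sumr_const mulNrn; apply/eqP; rewrite subr_eq0 eqr_nat; apply/eqP.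
apply: eq_card => v; rewrite !unfold_in /= andb_idl // => vs.
by apply: contraNneq ws => <-.
Qed.

Let push_sum x u : \sum_v x v = 1 -> \sum_v push x u v = 1.
Proof. by move=> x1; rewrite big_split /= x1 -mulr_sumr coef_sum mulr0 addr0. Qed.

Let push_ge0 x u : realization R K x -> 0 <= u <= 1 -> forall v, 0 <= push x u v.
Proof.
move=> [x0 _ _] /andP[u0 u1] v; have d0 := depth_ge0 x0.
rewrite /push /coef; case: eqP => _; first by rewrite addr_ge0 ?mulr_ge0.
case: ifP => vs; last by rewrite mulr0 addr0.
rewrite mulrN1 subr_ge0 (le_trans _ (depth_le x vs)) //.
by rewrite ler_piMl.
Qed.

Let supp (x : X) : {set V} := [set v | x v != 0]%SET.

Let push_id x u : depth x = 0 -> push x u = x.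
Proof. by move=> dx; apply/funext => v; rewrite /push dx mulr0 mul0r addr0. Qed.

Let supp_sub x : realization R K x -> depth x != 0 -> s \subset supp x.
Proof.
move=> [x0 _ _] dx; apply/fintype.subsetP => v vs; rewrite inE.
apply: contra dx => /eqP xv.
by rewrite eq_le depth_ge0 // andbT -xv depth_le.
Qed.

Let supp_t x : realization R K x -> depth x != 0 -> supp x \subset t.
Proof.
move=> Kx dx; have ss := supp_sub Kx dx; case: (Kx) => _ _.
rewrite -/(supp x) KE 2!inE => /orP[/eqP->|]; first exact: finset.subsetUr.
rewrite 2!inE => /orP[/eqP-> //|xL].
by move: sL; rewrite (sc_L.2 _ _ xL ss sN0).
Qed.

Let supp_push x u : realization R K x -> depth x != 0 -> supp (push x u) \subset t.
Proof.
move=> Kx dx; apply/fintype.subsetP => v; rewrite inE.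
apply: contraR => vt; have vx : x v = 0.
  apply/eqP; apply: contraR vt => xv.
  by apply: (fintype.subsetP (supp_t Kx dx)); rewrite inE.
rewrite /push vx add0r /coef; move: vt; rewrite /t !inE negb_or.
by move=> /andP[/negPf-> /negPf->]; rewrite mulr0.
Qed.

Let supp_neq0 x : \sum_v x v = 1 -> supp x != finset.set0.
Proof.
move=> x1; apply/eqP => x0; move: (oner_neq0 R); rewrite -x1 big1 ?eqxx // => v _.
by apply/eqP; apply: contraT => xv; have := finset.in_set0 v; rewrite -x0 inE xv.
Qed.

Lemma push_in x u : realization R K x -> 0 <= u <= 1 -> realization R K (push x u).
Proof.
move=> Kx u01; have [dx|dx] := eqVneq (depth x) 0; first by rewrite push_id.
case: (Kx) => x0 x1 _; split; [exact: push_ge0|exact: push_sum|].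
have tK : t \in K by rewrite KE !inE eqxx orbT.
apply: (sc_K.2 _ _ tK); first exact: supp_push.
by apply: supp_neq0; exact: push_sum.
Qed.

Lemma push0 x : push x 0 = x.
Proof. by apply/funext => v; rewrite /push !mul0r addr0. Qed.

Lemma push1 x : realization R K x -> realization R L (push x 1).
Proof.
move=> Kx; have Kp : realization R K (push x 1) by apply: push_in => //; lra.
have [v vs dv] := depth_attained Kx.
have pv : push x 1 v = 0.
  rewrite /push /coef vs; case: eqP => [vw|_]; first by rewrite vw (negPf ws) in vs.
  by rewrite dv mul1r mulrN1 subrr.
case: (Kp) => p0 p1 pK; split=> //; move: pK; rewrite KE -/(supp _) 2!inE.
have vp : v \notin supp (push x 1) by rewrite inE pv eqxx.
case/orP=> [/eqP sp|]; first by rewrite sp vs in vp.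
rewrite 2!inE => /orP[/eqP sp|//]; by rewrite sp !inE vs orbT in vp.
Qed.

Lemma push_fix x u : realization R L x -> push x u = x.
Proof.
move=> [x0 x1 xL]; apply: push_id; apply/eqP; apply: contraNT sL => dx.
apply: (sc_L.2 _ _ xL _ sN0); apply: supp_sub => //; split=> //.
by rewrite KE 4!inE xL !orbT.
Qed.

Lemma realization_sub x : realization R L x -> realization R K x.
Proof. by move=> [x0 x1 xL]; split=> //; rewrite KE 4!inE xL !orbT. Qed.

Lemma push_continuous (T : topologicalType) (g : T -> X) (h : T -> R) :
  continuous g -> continuous h -> continuous (fun z => push (g z) (h z)).
Proof.
move=> cg ch; apply: continuous_ptws => v.
have ce i : continuous (fun z => g z i).
  by apply: (continuous_comp2 cg (g := fun x : X => x i)); exact: eval_continuous.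
apply: (continuous_add (ce v)).
apply: (continuous_mul (g := fun=> coef v)); last exact: continuous_const.
apply: (continuous_mul ch).
exact: (@bigmin_continuous T V (index_enum V) (mem s) (fun i z => g z i)).
Qed.

(** At time 1 [push] retracts [K] onto [L], and a retract of a contractible space is
    contractible. *)
Lemma contractible_collapse :
  globally_contractible (realization R K) -> globally_contractible (realization R L).
Proof.
move=> [a [H [Ka cH HK H0 H1]]].
exists (push a 1), (fun z => push (H z) 1); split.
- exact: push1.
- by apply: (@push_continuous _ H (fun=> 1)) => //; exact: continuous_const.
- by move=> x u Lx u01; apply: push1; apply: HK => //; exact: realization_sub.
- by move=> x Lx; rewrite H0 ?push_fix //; exact: realization_sub.
- by move=> x Lx; rewrite H1 //; exact: realization_sub.
Qed.

(* Concatenation of [push] and of a contraction [H] of [L], written as a sum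
   so that it is continuous without gluing: the second term vanishes on the
   first half, and on the second half the first one is the endpoint of [push]. *)
Lemma contractible_expansion :
  globally_contractible (realization R L) -> globally_contractible (realization R K).
Proof.
move=> [a [H [La cH HL H0 H1]]].
pose lo (u : R) := Order.min (2 * u) 1; pose hi (u : R) := Order.max (2 * u - 1) 0.
exists a, (fun z v => push z.1 (lo z.2) v
  + (H (push z.1 1, hi z.2) v - push z.1 1 v)); split.
- exact: realization_sub.
- have c1 := @continuous_fst X R; have c2 := @continuous_snd X R.
  have cc (T : topologicalType) := @continuous_const T R.
  have c2u : continuous (fun z : X * R => 2 * z.2).
    by apply: continuous_mul; [exact: cc|exact: c2].
  have clo : continuous (fun z : X * R => lo z.2).
    move=> y; apply: (@continuous_min R _ (fun z : X * R => 2 * z.2) (fun=> 1)).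
      exact: c2u.
    exact: cc.
  have chi : continuous (fun z : X * R => hi z.2).
    move=> y; apply: (@continuous_max R _ (fun z : X * R => 2 * z.2 - 1) (fun=> 0)).
      by apply: (continuous_sub c2u) => //; exact: cc.
    exact: cc.
  have cp1 : continuous (fun z : X * R => push z.1 1).
    by apply: (push_continuous c1 (h := fun=> 1)); exact: cc.
  have ev (g : X * R -> X) v : continuous g -> continuous (fun z => g z v).
    by move=> cg; exact: (continuous_comp2 cg (@eval_continuous v)).
  apply: continuous_ptws => v.
  apply: continuous_add; first exact: (ev _ v (push_continuous c1 clo)).
  apply: continuous_sub; last exact: (ev _ v cp1).
  apply: (ev (fun z => H (push z.1 1, hi z.2)) v).
  exact: (continuous_comp2 (continuous_pair cp1 chi) cH).
- move=> x u Kx /andP[u0 u1]; have Lp := push1 Kx.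
  have [uh|uh] := leP (2 * u) 1.
    rewrite (_ : (fun v => _) = push x (2 * u)); first by apply: push_in => //; lra.
    apply/funext => v; rewrite /lo /hi min_l //= max_r; last by lra.
    by rewrite H0 // subrr addr0.
  rewrite (_ : (fun v => _) = H (push x 1, 2 * u - 1)).
    by apply: realization_sub; apply: HL => //; lra.
  apply/funext => v; rewrite /lo /hi /= min_r ?max_l; [|lra..].
  by rewrite addrC subrK.
- move=> x Kx; apply/funext => v /=; rewrite /lo /hi mulr0 min_l ?max_r ?sub0r ?lerN10 ?ler01 //.
  by rewrite push0 H0 ?subrr ?addr0 //; exact: push1.
- move=> x Kx; apply/funext => v /=; rewrite /lo /hi mulr1 min_r ?max_l; [|lra..].
  have -> : 2 - 1 = 1 :> R by lra.
  by rewrite addrC subrK H1 //; exact: push1.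
Qed.

End Push.

Lemma contractible_vertex (v : V) :
  globally_contractible (realization R [set [set v]]%SET).
Proof.
pose a : X := fun u => (u == v)%:R.
have all_a x : realization R [set [set v]]%SET x -> x = a.
  move=> [x0 x1]; rewrite inE => /eqP sx; apply/funext => u; rewrite /a.
  have xu i : i != v -> x i = 0.
    move=> iv; apply/eqP; apply: contraNT iv => xi.
    by rewrite -finset.in_set1 -sx inE.
  have [->|uv] := eqVneq u v; last exact: xu.
  by rewrite -x1 (bigD1 v) //= big1 ?addr0.
have Aa : realization R [set [set v]]%SET a.
  split=> [u||]; first by rewrite /a ler0n.
    rewrite (bigD1 v) //= big1 ?addr0 /a ?eqxx // => i /negPf-> //.
  rewrite inE; apply/eqP/setP => u; rewrite !inE /a.
  by case: (u == v); rewrite ?oner_eq0 ?eqxx.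
exists a, (fun z => z.1); split=> //; by [move=> y; exact: cvg_fst|move=> x /all_a].
Qed.

End Topology.

(** * Face counts, contractibility and closedness of built complexes *)

Section BuiltSets.
Local Open Scope set_scope.
Local Notation set0 := finset.set0.
Variable V : finType.
Implicit Types (K L : {set {set V}}) (B : seq ({set V} * {set V})).

Lemma card_built L B (P : pred {set V}) : simplicial_complex L -> builds L B ->
  #|[set s in built L B | P s]| = #|[set s in L | P s]| +
    sumn [seq ((b.1 != set0) && P b.1) + P b.2 | b <- B].
Proof.
elim: B L => [|b B IH] L sL /=; first by rewrite addn0.
case/andP=> fb bB; rewrite IH //; last exact: fits_complex.
rewrite addnA; congr (_ + _).
pose c := [set s in block_faces b | P s].
have -> : [set s in block_faces b :|: L | P s] = c :|: [set s in L | P s].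
  by apply/setP => s; rewrite !inE andb_orl.
rewrite cardsU [c :&: _](_ : _ = set0) ?cards0 ?subn0; last first.
  apply/setP => s; rewrite !inE; apply/negP => /andP[/andP[sb _] /andP[sL' _]].
  by have := fits_disjoint sL fb sb; rewrite sL'.
rewrite addnC; congr (_ + _).
have b12 : b.1 != set0 -> b.1 != b.2.
  by move=> /(fits_pair fb)[_ c2]; apply: contra_eq_neq c2 => ->; rewrite neq_ltn ltnSn.
rewrite /c /block_faces -sum1dep_card big_mkcondr /=.
case: ifPn => [_|b1N] /=.
  by rewrite add0n big_set1; case: (P _).
by rewrite big_setU1 ?inE ?b12 // big_set1; case: (P _); case: (P _).
Qed.

Variable R : realType.

(** Without critical blocks each step is an elementary expansion, and contractibility passes both
    ways across it. *)
Lemma contractible_builds L B : simplicial_complex L -> builds L B ->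
  all (fun b => b.1 != set0) B ->
  globally_contractible (realization R L) <->
  globally_contractible (realization R (built L B)).
Proof.
elim: B L => [|b B IH] L sL //= /andP[fb bB] /andP[bN BN].
rewrite -(IH _ (fits_complex sL fb) bB BN).
have /and5P[_ b1L _ _] := fb.
rewrite (negPf bN) /= => /exists_inP[w wb /eqP b1E].
have ws : w \notin b.1 by rewrite b1E !inE eqxx.
have b2E : w |: b.1 = b.2 by rewrite b1E finset.setD1K.
have KE : block_faces b :|: L = b.1 |: ((w |: b.1) |: L).
  by rewrite /block_faces (negPf bN) b2E finset.setUA.
have sK := fits_complex sL fb.
split; first exact: (contractible_expansion sK sL bN ws b1L KE).
exact: (contractible_collapse sK sL bN ws b1L KE).
Qed.

(** Descending one vertex at a time reduces closedness to facets, which can be tested by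
    computation. *)
Lemma facet_closed (Y : {set {set V}}) :
  (forall t w, t \in Y -> w \in t -> t :\ w != set0 -> t :\ w \in Y) ->
  forall s t : {set V}, t \in Y -> s \subset t -> s != set0 -> s \in Y.
Proof.
move=> facet s t; have [m] := ubnP #|t|; elim: m t => // m IH t /ltnSE-ct tY st sN.
have [-> //|nst] := eqVneq s t.
have [w wt sw] : exists2 w, w \in t & s \subset t :\ w.
  by apply: proper_sub_facet; rewrite finset.properEneq nst.
apply: (IH (t :\ w)) => //; last apply: facet => //.
  by apply: leq_trans ct; rewrite [X in _ < X](cardsD1 w) wt ltnSn.
by apply: contraNneq sN => e; rewrite -finset.subset0 -e.
Qed.

(** Any cut separates [c] from one of the two given vertices, and the edge from [c] to that vertex
    crosses it. *)
Lemma cone_vertex_connected (D : {set {set V}}) c :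
  [set c] \in D -> (forall v, [set v] \in D -> v != c -> [set c; v] \in D) ->
  cut_connected D.
Proof.
move=> cD adj S x y xS yS xD yD; have [cS|cS] := boolP (c \in S).
  by exists c, y; split=> //; apply: adj => //; apply: contraNneq yS => ->.
exists x, c; split=> //; rewrite finset.setUC; apply: adj => //.
by apply: contraNneq cS => <-.
Qed.

End BuiltSets.

(** * Faces as sorted lists *)

Section Encoding.
Local Open Scope set_scope.
Local Notation set0 := finset.set0.
Variable n : nat.
Implicit Types (s t u : seq nat) (b : seq nat * seq nat) (B : seq (seq nat * seq nat)).

Definition face s : {set 'I_n} := [set i : 'I_n | (i : nat) \in s].

(** Strict sorting makes the list of a face unique, so that faces can be compared as lists. *)
Definition wf s := sorted ltn s && all (gtn n) s.

Definition facets s := [seq [seq x <- s | x != w] | w <- s].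

Lemma mem_wf s x : wf s -> x \in s -> exists i : 'I_n, x = i.
Proof. by move=> /andP[_ /allP sn] /sn xn; exists (Ordinal xn). Qed.

Lemma face_sub s t : wf s -> (face s \subset face t) = all (mem t) s.
Proof.
move=> ws; apply/fintype.subsetP/allP => [st x xs|st i]; last by rewrite !inE => /st.
by have [i e] := mem_wf ws xs; move: (st i); rewrite !inE -e; apply.
Qed.

Lemma face_inj s t : wf s -> wf t -> face s = face t -> s = t.
Proof.
move=> ws wt e; have /andP[ss _] := ws; have /andP[st _] := wt.
apply: (irr_sorted_eq ltn_trans ltnn ss st) => x.
apply/idP/idP => [xs|xt].
  by have [i xi] := mem_wf ws xs; have := finset.in_set (fun j : 'I_n => (j : nat) \in t) i;
     rewrite -[finset _]/(face t) -e inE -xi xs => <-.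
by have [i xi] := mem_wf wt xt; have := finset.in_set (fun j : 'I_n => (j : nat) \in s) i;
   rewrite -[finset _]/(face s) e inE -xi xt => <-.
Qed.

Lemma face_eq s t : wf s -> wf t -> (face s == face t) = (s == t).
Proof. by move=> ws wt; apply/eqP/eqP => [/face_inj->|->]. Qed.

Lemma card_face s : wf s -> #|face s| = size s.
Proof.
move=> /andP[/(sorted_uniq ltn_trans ltnn) us /allP sn].
pose r : seq 'I_n := pmap insub s.
have e : map val r = s.
  rewrite pmap_filter; last exact: insubK.
  by apply/all_filterP/allP => x /sn xn; rewrite isSome_insub.
have ur : uniq r by rewrite -(map_inj_uniq val_inj) e.
rewrite -e size_map -(card_uniqP ur); apply: eq_card => i.
by rewrite inE mem_map //; exact: val_inj.
Qed.

Lemma face0 s : wf s -> (face s == set0) = (s == [::]).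
Proof. by move=> ws; rewrite -cards_eq0 card_face // size_eq0. Qed.

Lemma wf_filter (P : pred nat) s : wf s -> wf [seq x <- s | P x].
Proof.
move=> /andP[ss /allP sn]; rewrite /wf sorted_filter //; last exact: ltn_trans.
by apply/allP => x; rewrite mem_filter => /andP[_ /sn].
Qed.

Lemma faceD1 s (i : 'I_n) : face s :\ i = face [seq x <- s | x != i :> nat].
Proof. by apply/setP => j; rewrite !inE mem_filter. Qed.

Lemma wf_facets s u : wf s -> u \in facets s -> wf u.
Proof. by move=> ws /mapP[w _ ->]; exact: wf_filter. Qed.

Lemma facetsP s (i : 'I_n) : i \in face s -> exists2 u, u \in facets s & face s :\ i = face u.
Proof.
rewrite inE => si; exists [seq x <- s | x != i :> nat]; last exact: faceD1.
by apply/mapP; exists (i : nat).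
Qed.

(** From the lowest bit on, an entry [v] is written as [v] zeros closed by a one; this is the key in
    a binary trie. *)
Definition code s : BinNums.positive :=
  foldr (fun v c => iter v BinNums.xO (BinNums.xI c)) BinNums.xH s.

(* The stored list makes the membership test correct without injectivity of [code]. *)
Definition dict := FMapPositive.PositiveMap.t (seq nat).
Definition lookup (d : dict) s :=
  if FMapPositive.PositiveMap.find (code s) d is Some s' then s' == s else false.
Definition absent (d : dict) s :=
  if FMapPositive.PositiveMap.find (code s) d is Some _ then false else true.
Definition insert s (d : dict) : dict := FMapPositive.PositiveMap.add (code s) s d.
Definition empty : dict := FMapPositive.PositiveMap.empty _.

(** Two one-sided statements: a collision of codes can make both tests fail, but neither can succeed
    wrongly. *)
Definition represents (d : dict) (L : {set {set 'I_n}}) : Prop :=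
  (forall s, lookup d s -> face s \in L) /\
  (forall s, wf s -> absent d s -> face s \notin L).

Lemma represents_empty : represents empty set0.
Proof.
by split=> s; rewrite /lookup /empty ?FMapPositive.PositiveMap.gempty // inE.
Qed.

Lemma represents_insert d L s : wf s ->
  represents d L -> represents (insert s d) (face s |: L).
Proof.
move=> ws [dL Ld]; split=> t; rewrite /lookup /absent /insert.
  have [e|ne] := pselect (code t = code s).
    by rewrite e FMapPositive.PositiveMap.gss => /eqP <-; rewrite !inE eqxx.
  rewrite FMapPositive.PositiveMap.gso //.
  by move=> /dL tL; rewrite inE tL orbT.
move=> wt; have [e|ne] := pselect (code t = code s).
  by rewrite e FMapPositive.PositiveMap.gss.
rewrite FMapPositive.PositiveMap.gso //.
move=> /(Ld _ wt) tL; rewrite 2!inE negb_or tL andbT face_eq //.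
by apply/eqP => ts; apply: ne; rewrite ts.
Qed.

Definition fits_dict (d : dict) b : bool :=
  [&& wf b.2, b.2 != [::], absent d b.2, absent d b.1,
      all (fun u => [|| u == [::], u == b.1 | lookup d u]) (facets b.2) &
      (b.1 == [::]) || (b.1 \in facets b.2)].

Definition insert_block (d : dict) b : dict :=
  insert b.2 (if b.1 == [::] then d else insert b.1 d).

Fixpoint build (d : dict) B : option dict :=
  if B is b :: B' then
    if fits_dict d b then build (insert_block d b) B' else None
  else Some d.

Definition face_block b := (face b.1, face b.2).

Lemma wf_nil : wf [::].
Proof. by []. Qed.

Lemma fits_dictP d L b : represents d L -> fits_dict d b ->
  [/\ wf b.1, fits L (face_block b) &
      represents (insert_block d b) (block_faces (face_block b) :|: L)].
Proof.
move=> dL /and5P[w2 N2 a2 a1 /andP[facet shape]].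
have w1 : wf b.1.
  by case/orP: shape => [/eqP->|]; [exact: wf_nil|exact: wf_facets].
split=> //.
  rewrite /fits /= face0 // (dL.2 _ w2 a2) (dL.2 _ w1 a1) N2 /=.
  rewrite face0 //; apply/andP; split.
    apply/forall_inP => i /facetsP[u uf ->]; have wu := wf_facets w2 uf.
    rewrite face0 // face_eq //; have := allP facet _ uf.
    by case/or3P=> [->|->|/dL.1->]; rewrite ?orbT.
  case/orP: shape => [->//|/mapP[w wb b1E]]; apply/orP; right.
  have [i wi] := mem_wf w2 wb; apply/exists_inP; exists i; first by rewrite inE -wi.
  by rewrite faceD1 -wi b1E.
rewrite /insert_block /block_faces /= face0 //; case: ifP => _.
  exact: represents_insert.
rewrite -finset.setUA finset.setUCA.
by apply: represents_insert => //; exact: represents_insert.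
Qed.

Lemma buildP d L B d' : represents d L -> build d B = Some d' ->
  [/\ all (fun b => wf b.1 && wf b.2) B, builds L (map face_block B) &
      represents d' (built L (map face_block B))].
Proof.
elim: B d L => [|b B IH] d L dL /=; first by case=> <-.
case: ifP => // fb; have [w1 fL dL'] := fits_dictP dL fb.
move=> /(IH _ _ dL')[wB bB dB]; have /and5P[w2 _ _ _ _] := fb.
by rewrite w1 w2 wB fL bB.
Qed.

Definition block_list B : seq (seq nat) :=
  flatten [seq (if b.1 == [::] then [:: b.2] else [:: b.1; b.2]) | b <- B].

Lemma mem_built_list B (A : {set 'I_n}) : all (fun b => wf b.1 && wf b.2) B ->
  reflect (exists2 x, x \in block_list B & A = face x)
          (A \in built set0 (map face_block B)).
Proof.
move=> wB; rewrite mem_built inE /= has_map; apply: (iffP hasP) => [[b bB]|[x /flatten_mapP[b bB xb] ->]].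
  have /andP[w1 w2] := allP wB _ bB.
  rewrite /= /block_faces /= face0 // => sb.
  have : exists2 x, x \in (if b.1 == [::] then [:: b.2] else [:: b.1; b.2]) & A = face x.
    case: ifP sb => _; rewrite !inE; first by move/eqP; exists b.2; rewrite ?inE.
    by case/orP=> /eqP; [exists b.1|exists b.2]; rewrite ?inE ?eqxx ?orbT.
  by case=> x xb ->; exists x => //; apply/flatten_mapP; exists b.
exists b => //; have /andP[w1 w2] := allP wB _ bB; rewrite /= /block_faces /= face0 //.
by case: ifP xb => _; rewrite !inE; [move/eqP->|case/orP=> /eqP->]; rewrite eqxx ?orbT.
Qed.

Lemma wf_block_list B x : all (fun b => wf b.1 && wf b.2) B -> x \in block_list B -> wf x.
Proof.
move=> wB /flatten_mapP[b bB]; have /andP[w1 w2] := allP wB _ bB.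
by case: ifP => _; rewrite !inE; [move/eqP->|case/orP=> /eqP->].
Qed.

Definition faces_of (l : seq (seq nat)) : {set {set 'I_n}} := [set A | A \in map face l].

Lemma faces_ofP l (A : {set 'I_n}) :
  reflect (exists2 x, x \in l & A = face x) (A \in faces_of l).
Proof. by rewrite inE; exact: mapP. Qed.

Lemma mem_faces_of l x : all wf l -> wf x -> (face x \in faces_of l) = (x \in l).
Proof.
move=> wl wx; apply/faces_ofP/idP => [[y yl /face_inj e]|xl]; last by exists x.
by rewrite e // (allP wl).
Qed.

Lemma card_faces_of l i : all wf l -> uniq l ->
  #|[set A in faces_of l | #|A| == i]| = count (fun x => size x == i) l.
Proof.
move=> wl ul; rewrite -size_filter -(size_map face) -(card_uniqP _); last first.
  rewrite map_inj_in_uniq ?filter_uniq // => x y; rewrite !mem_filter.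
  by move=> /andP[_ /(allP wl) wx] /andP[_ /(allP wl) wy]; exact: face_inj.
apply: eq_card => s; rewrite !inE; apply/andP/mapP => [[/mapP[x xl ->] c]|[x]].
  by exists x; rewrite // mem_filter xl andbT -card_face // (allP wl).
rewrite mem_filter => /andP[c xl] ->; split; first exact: map_f.
by rewrite card_face // (allP wl).
Qed.

End Encoding.

(** * From the certificate to the theorem *)

(* Vertices 0 to 7 are those of D and 8 is o, while 2 is p; 0 is adjacent to all
   other vertices of D. *)
Section Example.
Variables core_023 core_012 thick thickening filler : seq (seq nat * seq nat).
Variables D_list Y_list : seq (seq nat).

(** The last four tests prove, by mutual inclusion of face lists, that different build orders give
    the same complex. The filler is run after [core_023] only, and the result transfers to
    [core_012] by this equality. *)
Definition builds_check : bool :=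
  if build 106 empty core_023 is Some d then
  if build 106 empty core_012 is Some d' then
  if build 106 empty (([::], [:: 2]) :: thick) is Some e then
  if build 106 d thickening is Some e' then
  if build 106 d filler is Some _ then
    [&& all (lookup d) (block_list core_012), all (lookup d') (block_list core_023),
        all (lookup e) (block_list (core_023 ++ thickening)) &
        all (lookup e') (block_list (([::], [:: 2]) :: thick))]
  else false else false else false else false else false.

Hypothesis builds_check_true : builds_check.

Local Open Scope set_scope.
Local Notation set0 := finset.set0.
Local Notation face := (face 106).
Local Notation face_block := (face_block 106).
Local Notation wf_blocks := (all (fun b => wf 106 b.1 && wf 106 b.2)).

Definition core : {set {set 'I_106}} := built set0 (map face_block core_023).
Definition example : {set {set 'I_106}} := built core (map face_block filler).

Let sub_built B B' d : represents d (built set0 (map face_block B')) ->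
  wf_blocks B -> all (lookup d) (block_list B) ->
  built set0 (map face_block B) \subset built set0 (map face_block B').
Proof.
move=> [dB' _] wB lB; apply/fintype.subsetP => s /(mem_built_list _ wB)[x xB ->].
exact/dB'/(allP lB).
Qed.

Let built_eq B B' d d' : represents d (built set0 (map face_block B)) ->
  represents d' (built set0 (map face_block B')) -> wf_blocks B -> wf_blocks B' ->
  all (lookup d') (block_list B) -> all (lookup d) (block_list B') ->
  built set0 (map face_block B) = built set0 (map face_block B').
Proof.
move=> r r' w w' l l'; apply/eqP.
by rewrite finset.eqEsubset (sub_built r' w l) (sub_built r w' l').
Qed.

Lemma builds_facts :
  [/\ [/\ wf_blocks (core_023 ++ filler), wf_blocks (core_012 ++ filler), wf_blocks thick & wf_blocks thickening],
      builds set0 (map face_block (core_023 ++ filler)),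
      builds set0 (map face_block (core_012 ++ filler)),
      built set0 (map face_block core_012) = core &
      [/\ builds set0 (map face_block (([::], [:: 2]) :: thick)),
          builds core (map face_block thickening) &
          built set0 (map face_block (([::], [:: 2]) :: thick)) =
          built core (map face_block thickening)]].
Proof.
have := builds_check_true; rewrite /builds_check.
case E1 : (build 106 empty core_023) => [d|//].
case E2 : (build 106 empty core_012) => [d'|//].
case E3 : (build 106 empty _) => [e|//].
case E4 : (build 106 d thickening) => [e'|//].
case E5 : (build 106 d filler) => [d''|//].
case/and4P=> l1 l2 l3 l4.
have r0 := represents_empty 106.
have [w1 b1 r1] := buildP r0 E1; have [w2 b2 r2] := buildP r0 E2.
have [w3 b3 r3] := buildP r0 E3; have [w4 b4 r4] := buildP r1 E4.
have [w5 b5 r5] := buildP r1 E5.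
have eq12 : built set0 (map face_block core_012) = core.
  exact: built_eq r2 r1 w2 w1 l1 l2.
have w14 : wf_blocks (core_023 ++ thickening) by rewrite all_cat w1 w4.
have r14 : represents e' (built set0 (map face_block (core_023 ++ thickening))).
  by rewrite map_cat built_cat.
have wE : [/\ wf_blocks (core_023 ++ filler), wf_blocks (core_012 ++ filler),
    wf_blocks thick & wf_blocks thickening].
  by rewrite !all_cat w1 w2 w4 w5.
have bE : builds set0 (map face_block (core_023 ++ filler)).
  by rewrite map_cat builds_cat b1 b5.
have bE' : builds set0 (map face_block (core_012 ++ filler)).
  by rewrite map_cat builds_cat b2 eq12 b5.
have := built_eq r3 r14 w3 w14 l4 l3; rewrite [X in _ = built _ X]map_cat built_cat => e34.
by split.
Qed.

Lemma example023 : example = built set0 (map face_block (core_023 ++ filler)).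
Proof. by rewrite map_cat built_cat. Qed.

Lemma example012 : example = built set0 (map face_block (core_012 ++ filler)).
Proof. by have [_ _ _ e _] := builds_facts; rewrite map_cat built_cat e. Qed.

Lemma example_complex : simplicial_complex example.
Proof.
have [_ b _ _ _] := builds_facts.
by rewrite example023; apply: builds_complex b; exact: simplicial_complex0.
Qed.

Definition example_list := block_list (core_023 ++ filler).

Lemma exampleP A : reflect (exists2 x, x \in example_list & A = face x) (A \in example).
Proof.
by rewrite example023; apply: mem_built_list; have [[w _ _ _] _ _ _ _] := builds_facts.
Qed.

Lemma wf_example x : x \in example_list -> wf 106 x.
Proof. by have [[w _ _ _] _ _ _ _] := builds_facts; exact: wf_block_list w. Qed.

Definition count_sizes (Q : pred nat) : nat :=
  sumn [seq ((b.1 != [::]) && Q (size b.1)) + Q (size b.2) | b <- core_023 ++ filler].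

Lemma example_count (Q : pred nat) :
  #|[set s in example | Q #|s|]| = count_sizes Q.
Proof.
have [[w _ _ _] b _ _ _] := builds_facts.
rewrite example023 (@card_built _ _ _ (fun s => Q #|s|) (simplicial_complex0 _) b).
rewrite (_ : [set _ in _ | _] = set0) ?cards0 ?add0n; last by apply/setP => s; rewrite !inE.
rewrite -map_comp; congr sumn; apply/eq_in_map => c /(allP w)/andP[w1 w2] /=.
by rewrite face0 // !card_face.
Qed.

Definition size_check : bool :=
  [&& all (fun s => size s <= 4) example_list,
      [seq count_sizes (pred1 k) | k <- iota 1 4] == [:: 106; 596; 1064; 573] &
      odd (count_sizes xpredT)].

Hypothesis size_check_true : size_check.

Lemma example_count_values :
  [seq #|[set s in example | #|s| == k]| | k <- iota 1 4] = [:: 106; 596; 1064; 573].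
Proof.
have /and3P[_ /eqP <- _] := size_check_true.
by apply: eq_map => k; exact: (example_count (pred1 k)).
Qed.

Lemma example_dimension : dimension example = 3.
Proof.
apply/eqP; rewrite eqn_leq; apply/andP; split.
  apply/bigmax_leqP => s /exampleP[x xl ->]; rewrite card_face ?wf_example //.
  have /and3P[/allP/(_ x xl) + _ _] := size_check_true.
  by case: (size x).
have [_ _ _] := example_count_values => c.
have : 0 < #|[set s in example | #|s| == 4]| by rewrite c.
rewrite card_gt0 => /set0Pn[s]; rewrite inE => /andP[sK /eqP s4].
by have := @leq_bigmax_cond _ (mem example) (fun s => #|s|.-1) s sK; rewrite s4.
Qed.

Lemma example_face_vector : face_vector example = [:: 106; 596; 1064; 573].
Proof.
rewrite /face_vector example_dimension; exact: example_count_values.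
Qed.

Lemma example_odd : odd #|example|.
Proof.
have /and3P[_ _] := size_check_true; rewrite -example_count.
by congr odd; apply: eq_card => s; rewrite !inE andbT.
Qed.

Lemma example_morse_vector (R : realType) B : wf_blocks B ->
  builds set0 (map face_block B) -> example = built set0 (map face_block B) ->
  is_discrete_morse_vector R example
    [seq count (fun b => (b.1 == [::]) && (size b.2 == k)) B | k <- iota 1 4].
Proof.
move=> w b e; have := building_morse_vector R b; rewrite -e example_dimension.
have cntE k : count (fun b : {set 'I_106} * {set 'I_106} => (b.1 == set0) && (#|b.2| == k)) (map face_block B) =
    count (fun b => (b.1 == [::]) && (size b.2 == k)) B.
  rewrite count_map; apply: eq_in_count => c /(allP w)/andP[w1 w2] /=.
  by rewrite face0 // card_face.
by rewrite /mkseq /= !cntE.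
Qed.

Definition morse_check : bool :=
  ([seq count (fun b => (b.1 == [::]) && (size b.2 == k)) (core_012 ++ filler) | k <- iota 1 4]
     == [:: 1; 1; 1; 0]) &&
  ([seq count (fun b => (b.1 == [::]) && (size b.2 == k)) (core_023 ++ filler) | k <- iota 1 4]
     == [:: 1; 0; 1; 1]).

Hypothesis morse_check_true : morse_check.

Lemma example_morse_012 (R : realType) : is_discrete_morse_vector R example [:: 1; 1; 1; 0].
Proof.
have [[_ w _ _] _ b _ _] := builds_facts; have /andP[/eqP <- _] := morse_check_true.
by apply: example_morse_vector; rewrite -?example012.
Qed.

Lemma example_morse_023 (R : realType) : is_discrete_morse_vector R example [:: 1; 0; 1; 1].
Proof.
have [[w _ _ _] b _ _ _] := builds_facts; have /andP[_ /eqP <-] := morse_check_true.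
by apply: example_morse_vector; rewrite -?example023.
Qed.

Definition pairs_check : bool :=
  all (fun b => b.1 != [::]) (thick ++ thickening ++ filler).

Hypothesis pairs_check_true : pairs_check.

(** Both [filler] and [thickening] expand the core, and the thickened core is also built from the
    vertex 2 by expansions; contractibility travels along this chain. *)
Lemma example_contractible (R : realType) : contractible R (realization R example).
Proof.
have [[w _ wT wTT] b _ _ [bA bB eAB]] := builds_facts.
apply: globally_contractibleW.
have pairs B : wf_blocks B -> all (fun b => b.1 != [::]) B ->
    all (fun b : {set 'I_106} * {set 'I_106} => b.1 != set0) (map face_block B).
  move=> wB pB; rewrite all_map; apply/allP => c cB /=.
  by have /andP[w1 _] := allP wB c cB; rewrite face0 // (allP pB).
have := pairs_check_true; rewrite /pairs_check !all_cat => /and3P[p1 p2 p3].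
move: w b; rewrite all_cat map_cat builds_cat => /andP[w1 w2] /andP[b1 b2].
have sc0 := simplicial_complex0 'I_106.
have sc := builds_complex sc0 b1.
apply/(contractible_builds R sc b2); first exact: pairs.
apply/(contractible_builds R sc bB); first by apply: pairs wTT _.
rewrite -eAB; move: bA; rewrite [map _ _]/= => /andP[bv bT].
have scv := fits_complex sc0 bv.
apply/(contractible_builds R scv bT); first by apply: pairs wT _.
rewrite (_ : _ :|: set0 = [set [set (Ordinal (isT : 2 < 106))]]); first exact: contractible_vertex.
rewrite finset.setU0 /block_faces /= face0 //; congr [set _].
by apply/setP => i; rewrite !inE.
Qed.

Definition proper_list (s t : seq nat) := all (mem t) s && (size s < size t).
Definition two_cofaces (l : seq (seq nat)) s :=
  if [seq t <- l | proper_list s t] is [:: t1, t2 & _] then t1 != t2 else false.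
Definition link8 (t : seq nat) := [seq x <- t | x != 8].

(** The vertices of [D] are 0 to 7, so appending 8, or prefixing 0 to another vertex, keeps a list
    sorted. *)
Definition D_check : bool :=
  [&& all (wf 106) D_list, uniq D_list,
      all (fun t => all (fun u => (u == [::]) || (u \in D_list)) (facets t)) D_list,
      all (fun s => [&& 8 \notin s, size s <= 3 & rcons s 8 \in block_list core_023]) D_list,
      all (fun s => (size s <= 2) ==> (s \in Y_list) && two_cofaces D_list s) D_list,
      [:: 2] \in D_list, [:: 0] \in D_list,
      all (fun s => (size s == 1) ==> (s == [:: 0]) || (0 :: s \in D_list)) D_list &
      count (fun s => size s == 1) D_list + count (fun s => size s == 3) D_list
        <= (count (fun s => size s == 2) D_list).+1].

Definition Y_check : bool :=
  [&& all (wf 106) Y_list,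
      all (fun t => all (fun u => (u == [::]) || (u \in Y_list)) (facets t)) Y_list,
      all (mem (block_list core_023)) Y_list,
      all (fun s => [|| s == [:: 2; 8], size s == 3 | two_cofaces Y_list s]) Y_list,
      all (fun t => (size t == 4) ==> all (fun u => u \notin Y_list) (facets t)) example_list,
      has (proper_list [:: 2; 8]) Y_list,
      all (fun t => (8 \in t) ==> (t \in Y_list) || (link8 t \in D_list)) example_list &
      all (fun t => (8 \in t) && (link8 t \in D_list) ==> (t == [:: 2; 8])) Y_list].

Hypothesis D_check_true : D_check.
Hypothesis Y_check_true : Y_check.

Let D := faces_of 106 D_list.
Let Y := faces_of 106 Y_list.
Let o : 'I_106 := Ordinal (isT : 8 < 106).
Let p : 'I_106 := Ordinal (isT : 2 < 106).

Let face_proper s t : wf 106 s -> wf 106 t -> proper_list s t -> face s \proper face t.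
Proof.
by move=> ws wt /andP[st c]; rewrite finset.properEcard face_sub // st !card_face.
Qed.

Let two_cofacesP l s : all (wf 106) l -> wf 106 s -> two_cofaces l s ->
  exists t1 t2, [/\ t1 \in faces_of 106 l, t2 \in faces_of 106 l, t1 != t2,
    face s \proper t1 & face s \proper t2].
Proof.
move=> wl ws; rewrite /two_cofaces.
case F : [seq t <- l | proper_list s t] => [|t1 [|t2 r]] // t12.
have inl t : t \in [:: t1, t2 & r] -> [/\ t \in l, wf 106 t & proper_list s t].
  by rewrite -F mem_filter => /andP[pt tl]; rewrite tl pt (allP wl).
have [l1 w1 p1] := inl t1 (mem_head _ _).
have [|l2 w2 p2] := inl t2; first by rewrite !inE eqxx orbT.
by exists (face t1), (face t2); split; rewrite ?mem_faces_of ?face_eq ?face_proper.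
Qed.

Let closed_list l : all (wf 106) l ->
  all (fun t => all (fun u => (u == [::]) || (u \in l)) (facets t)) l ->
  forall s t : {set 'I_106}, t \in faces_of 106 l -> s \subset t -> s != set0 -> s \in faces_of 106 l.
Proof.
move=> wl cl; apply: facet_closed => t i /faces_ofP[x xl ->] /facetsP[u uf ->].
have wu := wf_facets (allP wl _ xl) uf; rewrite face0 // mem_faces_of //.
by have /orP[->|->] := allP (allP cl _ xl) _ uf.
Qed.

Let example_in x : x \in block_list core_023 -> face x \in example.
Proof.
move=> xl; apply/exampleP; exists x => //.
by rewrite /example_list /block_list map_cat flatten_cat mem_cat xl.
Qed.

Let link8E x : face x :\ o = face (link8 x).
Proof. exact: faceD1. Qed.

Let opE : [set o; p] = face [:: 2; 8].
Proof. by apply/setP => i; rewrite !inE orbC. Qed.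

Lemma example_noncollapsible : ~ collapsible example.
Proof.
have /and5P[wD uD cD fD /and5P[protD pD zD adj euler]] := D_check_true.
have /and5P[wY cY YK protY /and4P[maxY aY star Ystar]] := Y_check_true.
have w28 : wf 106 [:: 2; 8] by [].
have wx := wf_example; have scK := example_complex.
apply: (@cone_noncollapsible _ example Y D o p) => //.
- by apply/fintype.subsetP => s /faces_ofP[x xl ->]; apply: example_in; exact: (allP YK).
- exact: closed_list.
- move=> s /faces_ofP[x xl ->]; rewrite opE (face_eq (allP wY x xl) w28) => nx.
  have := allP protY x xl; rewrite (negPf nx) /= => /orP[/eqP s3|]; last first.
    by right; apply: two_cofacesP; rewrite ?(allP wY).
  (* A proper coface of the triangle would contain a tetrahedron of [example] with the triangle as a
     facet, which [maxY] excludes. *)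
  left=> t tK; apply/negP => /fintype.properP[xt [w wt wnx]].
  pose t' := w |: face x.
  have t'K : t' \in example.
    apply: scK.2 tK _ _; first by rewrite finset.subUset finset.sub1set wt xt.
    by apply/set0Pn; exists w; rewrite !inE eqxx.
  have /exampleP[y yl yE] := t'K.
  have sy : size y = 4.
    by rewrite -(card_face (wx y yl)) -yE cardsU1 wnx card_face ?(allP wY) // s3.
  have wy : w \in face y by rewrite -yE !inE eqxx.
  have [u uf uE] := facetsP wy.
  have := allP maxY y yl; rewrite sy => /allP/(_ u uf)/negP; apply.
  rewrite -(_ : x = u) //; apply: (@face_inj 106); first exact: (allP wY).
    exact: wf_facets (wx y yl) uf.
  by rewrite -uE -yE finset.setU1K.
- case/hasP: aY => t tl pt; exists (face t); first by apply/faces_ofP; exists t.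
  by rewrite opE; exact: face_proper w28 (allP wY t tl) pt.
- exact: closed_list.
- move=> s /faces_ofP[x xl ->]; have /and3P[nx sx cx] := allP fD x xl.
  rewrite card_face ?(allP wD) // inE; split=> //.
  rewrite (_ : o |: face x = face (rcons x 8)); first exact: example_in.
  by apply/setP => i; rewrite !inE mem_rcons inE.
- move=> s /faces_ofP[x xl ->]; rewrite card_face ?(allP wD) // => sx.
  have := allP protD x xl; rewrite sx => /andP[xY _].
  by rewrite mem_faces_of // (allP wD).
- move=> s /faces_ofP[x xl ->]; rewrite card_face ?(allP wD) // => sx.
  have := allP protD x xl; rewrite sx => /andP[_ x2].
  by apply: two_cofacesP; rewrite ?(allP wD).
- rewrite (_ : [set p] = face [:: 2]); first by rewrite mem_faces_of.
  by apply/setP => i; rewrite !inE.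
- have setE (i : 'I_106) : [set i] = face [:: (i : nat)] by apply/setP => j; rewrite !inE.
  have wi (i : 'I_106) : wf 106 [:: (i : nat)] by rewrite /wf /= ltn_ord.
  pose z : 'I_106 := Ordinal (isT : 0 < 106).
  apply: (@cone_vertex_connected _ _ z); first by rewrite setE mem_faces_of.
  move=> i iD iz; have il : [:: (i : nat)] \in D_list by rewrite -(mem_faces_of wD (wi i)) -setE.
  have := allP adj _ il; rewrite /= eqseq_cons andbT => /orP[/eqP e|zi].
    by case/eqP: iz; apply/val_inj.
  rewrite (_ : [set z; i] = face [:: 0; (i : nat)]); first by apply/faces_ofP; exists [:: 0; i : nat].
  by apply/setP => j; rewrite !inE.
- by rewrite !card_faces_of.
- move=> t /exampleP[x xl ->]; rewrite inE => ox.
  have := allP star x xl; rewrite ox => /orP[xY|xD].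
    by left; rewrite mem_faces_of // wx.
  by right; rewrite link8E mem_faces_of //; exact: wf_filter (wx x xl).
move=> t /faces_ofP[x xl ->]; rewrite inE link8E => ox.
rewrite mem_faces_of //; last exact: wf_filter (allP wY x xl).
by move=> xD; have := allP Ystar x xl; rewrite ox xD /= opE => /eqP->.
Qed.

Let morse_lower (R : realType) c : is_discrete_morse_vector R example c -> 3 <= sumn c.
Proof.
case=> f fM <-; apply: noncollapsible_morse_vector fM.
- exact: example_complex.
- exact: example_odd.
- exact: example_noncollapsible.
Qed.

Lemma certified_example (R : realType) :
  exists (V : finType) (K : {set {set V}}),
    simplicial_complex K /\
    dimension K = 3 /\
    contractible R (realization R K) /\
    ~ collapsible K /\
    face_vector K = [:: 106; 596; 1064; 573] /\
    [:: 1; 1; 1; 0] <> [:: 1; 0; 1; 1] /\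
    optimal_discrete_morse_vector R K [:: 1; 1; 1; 0] /\
    optimal_discrete_morse_vector R K [:: 1; 0; 1; 1].
Proof.
exists 'I_106, example; split; first exact: example_complex.
split; first exact: example_dimension.
split; first exact: example_contractible.
split; first exact: example_noncollapsible.
split; first exact: example_face_vector.
split; first by [].
(* Both vectors have sum 3, the bound of [morse_lower]. *)
split; split.
- exact: example_morse_012.
- by move=> c /morse_lower.
- exact: example_morse_023.
- by move=> c /morse_lower.
Qed.

End Example.

(** * The certificate *)

Definition dunce_hat : seq (seq nat) :=
  [:: [:: 0; 1; 3]; [:: 0; 1; 6]; [:: 0; 1; 7]; [:: 0; 2; 3]; [:: 0; 2; 4]; [:: 0; 2; 5];
      [:: 0; 4; 5]; [:: 0; 6; 7]; [:: 1; 2; 4]; [:: 1; 2; 6];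
      [:: 1; 2; 7]; [:: 1; 3; 4]; [:: 2; 3; 7]; [:: 2; 5; 6]; [:: 3; 4; 5];
      [:: 3; 5; 7]; [:: 5; 6; 7]].

(** Read backwards, a collapse of [N] to the vertex 2. Coned with 8, the same blocks build the cone
    over [N] from the edge joining 2 and 8. *)
Definition N_blocks : seq (seq nat * seq nat) :=
  [:: ([:: 4], [:: 2; 4]); ([:: 5], [:: 4; 5]); ([:: 3], [:: 3; 5]);
      ([:: 7], [:: 5; 7]); ([:: 0], [:: 0; 7]); ([:: 1], [:: 1; 2]);
      ([:: 6], [:: 2; 6]); ([:: 1; 4], [:: 1; 2; 4]);
      ([:: 3; 4], [:: 3; 4; 5]); ([:: 2; 5], [:: 2; 4; 5]);
      ([:: 3; 7], [:: 3; 5; 7]); ([:: 1; 5], [:: 1; 2; 5]);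
      ([:: 1; 7], [:: 1; 5; 7]); ([:: 1; 3], [:: 1; 3; 4]);
      ([:: 0; 1], [:: 0; 1; 7]); ([:: 0; 3], [:: 0; 1; 3]);
      ([:: 5; 6], [:: 2; 5; 6]); ([:: 6; 7], [:: 5; 6; 7]);
      ([:: 2; 7], [:: 1; 2; 7]); ([:: 0; 6], [:: 0; 6; 7]);
      ([:: 2; 3], [:: 2; 3; 7]); ([:: 3; 6], [:: 2; 3; 6]);
      ([:: 4; 7], [:: 4; 5; 7]); ([:: 0; 2], [:: 0; 2; 3]);
      ([:: 1; 6], [:: 1; 5; 6]); ([:: 0; 4], [:: 0; 2; 4]);
      ([:: 0; 5], [:: 0; 2; 5]); ([:: 4; 6], [:: 1; 4; 6]);
      ([:: 0; 4; 5], [:: 0; 2; 4; 5]); ([:: 1; 2; 6], [:: 1; 2; 5; 6]);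
      ([:: 1; 6; 7], [:: 1; 5; 6; 7]); ([:: 0; 1; 6], [:: 0; 1; 6; 7])].

(** Read backwards, the collapse of [N] to [D]: each tetrahedron is now paired with a triangle
    outside [D]. *)
Definition ND_blocks : seq (seq nat * seq nat) :=
  [:: ([:: 4; 7], [:: 4; 5; 7]); ([:: 1; 6; 7], [:: 0; 1; 6; 7]);
      ([:: 4; 6], [:: 1; 4; 6]); ([:: 3; 6], [:: 2; 3; 6]);
      ([:: 1; 5], [:: 1; 5; 6]); ([:: 1; 2; 5], [:: 1; 2; 5; 6]);
      ([:: 2; 4; 5], [:: 0; 2; 4; 5]); ([:: 1; 5; 7], [:: 1; 5; 6; 7])].

(** [Y] relative to the edges of [D]. The last block adds the edge joining 2 and 8 with its only
    triangle in [Y], so the collapse starts there. *)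
Definition Y_blocks : seq (seq nat * seq nat) :=
  [:: ([:: 16], [:: 7; 16]); ([:: 9], [:: 5; 9]); ([:: 17], [:: 5; 17]);
      ([:: 11], [:: 11; 16]); ([:: 12], [:: 4; 12]); ([:: 8], [:: 8; 16]);
      ([:: 15], [:: 1; 15]); ([:: 10], [:: 6; 10]); ([:: 13], [:: 9; 13]);
      ([:: 14], [:: 2; 14]); ([:: 0; 16], [:: 0; 7; 16]);
      ([:: 1; 16], [:: 1; 7; 16]); ([:: 0; 17], [:: 0; 5; 17]);
      ([:: 6; 17], [:: 0; 6; 17]); ([:: 2; 10], [:: 2; 6; 10]);
      ([:: 1; 14], [:: 1; 2; 14]); ([:: 7; 14], [:: 1; 7; 14]);
      ([:: 3; 16], [:: 1; 3; 16]); ([:: 3; 14], [:: 2; 3; 14]);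
      ([:: 4; 16], [:: 0; 4; 16]); ([:: 0; 10], [:: 0; 2; 10]);
      ([:: 0; 14], [:: 0; 3; 14]); ([:: 1; 10], [:: 1; 6; 10]);
      ([:: 4; 10], [:: 0; 4; 10]); ([:: 4; 9], [:: 4; 5; 9]);
      ([:: 6; 9], [:: 5; 6; 9]); ([:: 10; 15], [:: 1; 10; 15]);
      ([:: 2; 9], [:: 2; 4; 9]); ([:: 12; 16], [:: 4; 12; 16]);
      ([:: 8; 11], [:: 8; 11; 16]); ([:: 6; 13], [:: 6; 9; 13]);
      ([:: 7; 17], [:: 5; 7; 17]); ([:: 3; 11], [:: 3; 11; 16]);
      ([:: 2; 13], [:: 2; 6; 13]); ([:: 5; 14], [:: 5; 7; 14]);
      ([:: 1; 9], [:: 1; 2; 9]); ([:: 3; 10], [:: 3; 4; 10]);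
      ([:: 5; 13], [:: 2; 5; 13]); ([:: 0; 13], [:: 0; 5; 13]);
      ([:: 3; 17], [:: 3; 7; 17]); ([:: 3; 13], [:: 0; 3; 13]);
      ([:: 5; 10], [:: 3; 5; 10]); ([:: 4; 11], [:: 3; 4; 11]);
      ([:: 5; 15], [:: 5; 10; 15]); ([:: 4; 14], [:: 4; 5; 14]);
      ([:: 2; 17], [:: 2; 3; 17]); ([:: 3; 15], [:: 3; 5; 15]);
      ([:: 8; 12], [:: 8; 12; 16]); ([:: 13; 15], [:: 3; 13; 15]);
      ([:: 11; 12], [:: 8; 11; 12]); ([:: 3; 9], [:: 1; 3; 9]);
      ([:: 4; 17], [:: 2; 4; 17]); ([:: 6; 15], [:: 1; 6; 15]);
      ([:: 14; 17], [:: 4; 14; 17]); ([:: 7; 15], [:: 6; 7; 15]);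
      ([:: 7; 13], [:: 7; 13; 15]); ([:: 1; 11], [:: 1; 4; 11]);
      ([:: 0; 11], [:: 0; 1; 11]); ([:: 2; 11], [:: 0; 2; 11]);
      ([:: 7; 9], [:: 3; 7; 9]); ([:: 7; 11], [:: 2; 7; 11]);
      ([:: 9; 11], [:: 7; 9; 11]); ([:: 6; 14], [:: 0; 6; 14]);
      ([:: 1; 12], [:: 1; 4; 12]); ([:: 0; 12], [:: 0; 1; 12]);
      ([:: 11; 13], [:: 9; 11; 13]); ([:: 12; 13], [:: 11; 12; 13]);
      ([:: 7; 12], [:: 7; 12; 13]); ([:: 2; 12], [:: 2; 7; 12]);
      ([:: 5; 12], [:: 2; 5; 12]); ([:: 6; 12], [:: 5; 6; 12]);
      ([:: 12; 14], [:: 6; 12; 14]); ([:: 12; 17], [:: 12; 14; 17]);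
      ([:: 6; 16], [:: 6; 7; 16]); ([:: 16; 17], [:: 6; 16; 17]);
      ([:: 0; 9], [:: 0; 7; 9]); ([:: 9; 12], [:: 0; 9; 12]);
      ([:: 9; 17], [:: 9; 12; 17]); ([:: 9; 16], [:: 9; 16; 17]);
      ([:: 8; 9], [:: 8; 9; 16]); ([:: 2; 8], [:: 2; 8; 9])].

(** The triangle on 0, 1, 3 is left out; the critical edge [[:: 2; 6]] closes the circle that
    remains after collapsing. *)
Definition D_minus_triangle_blocks : seq (seq nat * seq nat) :=
  [:: ([:: 4], [:: 2; 4]); ([:: 0], [:: 0; 4]); ([:: 6], [:: 0; 6]);
      ([::], [:: 2; 6]); ([:: 1], [:: 1; 6]); ([:: 7], [:: 6; 7]);
      ([:: 3], [:: 3; 7]); ([:: 5], [:: 2; 5]); ([:: 0; 2], [:: 0; 2; 4]);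
      ([:: 0; 5], [:: 0; 2; 5]); ([:: 4; 5], [:: 0; 4; 5]);
      ([:: 5; 6], [:: 2; 5; 6]); ([:: 1; 2], [:: 1; 2; 6]);
      ([:: 5; 7], [:: 5; 6; 7]); ([:: 0; 7], [:: 0; 6; 7]);
      ([:: 3; 5], [:: 3; 5; 7]); ([:: 0; 1], [:: 0; 1; 6]);
      ([:: 1; 7], [:: 0; 1; 7]); ([:: 2; 7], [:: 1; 2; 7]);
      ([:: 3; 4], [:: 3; 4; 5]); ([:: 1; 4], [:: 1; 2; 4]);
      ([:: 2; 3], [:: 2; 3; 7]); ([:: 0; 3], [:: 0; 2; 3]);
      ([:: 1; 3], [:: 1; 3; 4])].

(** The edge joining 2 and 8 comes from [Y]. The triangle left out of [D] enters last, as the free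
    face of its cone. *)
Definition cone_blocks_012 : seq (seq nat * seq nat) :=
  [:: ([:: 0; 8], [:: 0; 2; 8]); ([:: 1; 8], [:: 1; 2; 8]);
      ([::], [:: 0; 1; 8]); ([:: 3; 8], [:: 2; 3; 8]);
      ([:: 5; 8], [:: 2; 5; 8]); ([:: 4; 8], [:: 4; 5; 8]);
      ([:: 6; 8], [:: 1; 6; 8]); ([:: 7; 8], [:: 1; 7; 8]);
      ([:: 0; 7; 8], [:: 0; 1; 7; 8]); ([:: 0; 6; 8], [:: 0; 1; 6; 8]);
      ([:: 6; 7; 8], [:: 0; 6; 7; 8]); ([:: 2; 7; 8], [:: 1; 2; 7; 8]);
      ([:: 2; 6; 8], [:: 1; 2; 6; 8]); ([:: 5; 6; 8], [:: 2; 5; 6; 8]);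
      ([:: 5; 7; 8], [:: 5; 6; 7; 8]); ([:: 3; 7; 8], [:: 2; 3; 7; 8]);
      ([:: 0; 5; 8], [:: 0; 2; 5; 8]); ([:: 3; 5; 8], [:: 3; 5; 7; 8]);
      ([:: 0; 4; 8], [:: 0; 4; 5; 8]); ([:: 2; 4; 8], [:: 0; 2; 4; 8]);
      ([:: 1; 4; 8], [:: 1; 2; 4; 8]); ([:: 3; 4; 8], [:: 3; 4; 5; 8]);
      ([:: 1; 3; 8], [:: 1; 3; 4; 8]); ([:: 0; 3; 8], [:: 0; 2; 3; 8]);
      ([:: 0; 1; 3], [:: 0; 1; 3; 8])].

(** Here the triangle on 0, 1, 3 is already present, so the last tetrahedron has no new facet to
    pair with and is critical. *)
Definition cone_blocks_023 : seq (seq nat * seq nat) :=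
  [:: ([:: 0; 8], [:: 0; 2; 8]); ([:: 1; 8], [:: 1; 2; 8]);
      ([::], [:: 0; 1; 8]); ([:: 3; 8], [:: 0; 3; 8]);
      ([:: 4; 8], [:: 0; 4; 8]); ([:: 6; 8], [:: 2; 6; 8]);
      ([:: 5; 8], [:: 2; 5; 8]); ([:: 7; 8], [:: 1; 7; 8]);
      ([:: 5; 6; 8], [:: 2; 5; 6; 8]); ([:: 1; 6; 8], [:: 1; 2; 6; 8]);
      ([:: 0; 7; 8], [:: 0; 1; 7; 8]); ([:: 0; 5; 8], [:: 0; 2; 5; 8]);
      ([:: 0; 6; 8], [:: 0; 1; 6; 8]); ([:: 2; 7; 8], [:: 1; 2; 7; 8]);
      ([:: 2; 3; 8], [:: 0; 2; 3; 8]); ([:: 6; 7; 8], [:: 0; 6; 7; 8]);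
      ([:: 2; 4; 8], [:: 0; 2; 4; 8]); ([:: 4; 5; 8], [:: 0; 4; 5; 8]);
      ([:: 5; 7; 8], [:: 5; 6; 7; 8]); ([:: 1; 4; 8], [:: 1; 2; 4; 8]);
      ([:: 3; 7; 8], [:: 2; 3; 7; 8]); ([:: 3; 5; 8], [:: 3; 5; 7; 8]);
      ([:: 3; 4; 8], [:: 3; 4; 5; 8]); ([:: 1; 3; 8], [:: 1; 3; 4; 8]);
      ([::], [:: 0; 1; 3; 8])].

Fixpoint sublists (s : seq nat) : seq (seq nat) :=
  if s is x :: s' then sublists s' ++ [seq x :: t | t <- sublists s'] else [:: [::]].

Definition closure_list (l : seq (seq nat)) : seq (seq nat) :=
  [seq s <- undup (flatten [seq sublists s | s <- l]) | s != [::]].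

Definition Y_triangles : seq (seq nat) :=
  [seq b.2 | b <- Y_blocks & size b.2 == 3].

Definition D_list := closure_list dunce_hat.
Definition Y_list := closure_list Y_triangles.

Definition cone_block (b : seq nat * seq nat) := (rcons b.1 8, rcons b.2 8).

(* The first 392 pairs and the first 552 triples of vertices [>= 18], in
   colexicographic order; coning them off from 0 is collapsible and brings the
   face vector from (18, 116, 120, 21) to the required one. *)
Definition filler_edges : seq (seq nat) :=
  take 392 [seq [:: i; j] | j <- iota 18 29, i <- iota 18 (j - 18)].
Definition filler_triangles : seq (seq nat) :=
  take 552 (flatten [seq [seq [:: i; j; k] | j <- iota 18 (k - 18), i <- iota 18 (j - 18)]
                    | k <- iota 18 16]).
(** The triples use only the vertices 18 to 33, whose 120 pairs come first in colexicographic order,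
    so their edges are present when needed. *)
Definition filler : seq (seq nat * seq nat) :=
  [seq (s, 0 :: s) | s <- [seq [:: v] | v <- iota 18 88] ++ filler_edges ++ filler_triangles].

Definition core_023 := ([::], [:: 2]) :: N_blocks ++ Y_blocks ++ cone_blocks_023.
Definition core_012 :=
  ([::], [:: 2]) :: D_minus_triangle_blocks ++ Y_blocks ++ cone_blocks_012 ++ ND_blocks.

(* The union of the core with the cone over all of N, built from a vertex and
   from the core by pairs only. *)
Definition thick := N_blocks ++ Y_blocks ++ map cone_block N_blocks.
Definition thickening := map cone_block ND_blocks.

Theorem theorem3p1 (R : realType) :
  exists (V : finType) (K : {set {set V}}),
    simplicial_complex K /\
    dimension K = 3 /\
    contractible R (realization R K) /\
    ~ collapsible K /\
    face_vector K = [:: 106; 596; 1064; 573] /\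
    [:: 1; 1; 1; 0] <> [:: 1; 0; 1; 1] /\
    optimal_discrete_morse_vector R K [:: 1; 1; 1; 0] /\
    optimal_discrete_morse_vector R K [:: 1; 0; 1; 1].
Proof.
apply: (@certified_example core_023 core_012 thick thickening filler D_list Y_list);
  by vm_compute.
Qed.
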